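(* Let $m\geq 3$ be an odd integer and let $N>2m$ be an integer. Then there exist real numbers $a_0,\dots,a_{m-1}$ with $\operatorname{sign}(a_k)=(-1)^k$ for all $0\leq k\leq m-1$ (that is, $(-1)^k a_k>0$) and an entire radial solution $u$ on $\mathbb{R}^N$ of $$ \begin{cases} (-\Delta)^m u=e^u,\\ u^{(2k+1)}(0)=0 & \text{for all } 0\leq k\leq m-1,\\ \Delta^k u(0)=a_k & \text{for all } 0\leq k\leq m-1, \end{cases} $$ such that $u$ is stable in $\mathbb{R}^N$.
   Context: Radial functions on $\mathbb{R}^N$ are written $u(x)=u(r)$ with $r=|x|$, and the Laplacian acts on them by $\Delta u=r^{1-N}(r^{N-1}u')'$. Solutions are smooth; ''entire'' means defined on all of $\mathbb{R}^N$. For $m$ odd, a solution $u$ of $(-\Delta)^m u=e^u$ in $\mathbb{R}^N$ is called stable in $\mathbb{R}^N$ if $$\int_{\mathbb{R}^N}|\nabla(\Delta^{\frac{m-1}{2}}\phi)|^2\,dx-\int_{\mathbb{R}^N}e^u\phi^2\,dx\geq 0\quad\text{for every }\phi\in C_0^\infty(\mathbb{R}^N).$$ *)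

(* Defs.v *)
From HB Require Import structures.
From mathcomp Require Import all_boot all_order all_algebra.
From mathcomp Require Import all_classical all_reals all_analysis.
Set Implicit Arguments.
Unset Strict Implicit.
Unset Printing Implicit Defensive.
Import Order.TTheory GRing.Theory Num.Theory.
Import numFieldNormedType.Exports.
Local Open Scope classical_set_scope.
Local Open Scope ring_scope.

(** The library has Lebesgue measure on R only.  Lebesgue measure on R^n is built
    by recursion on [n] as the image of [lebesgue_measure \x lebesgue_tuple n]
    under [(x, t) |-> x :: t]; the carrier is [n.-tuple R], which has the product
    sigma-algebra in the library, whereas ['rV[R]_n] has none.
    [lebesgue_tuple_box] gives its value on boxes. *)

Lemma sigma_finite_product d1 d2 (T1 : measurableType d1)
    (T2 : measurableType d2) (R : realType)
    (m1 : {sigma_finite_measure set T1 -> \bar R})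
    (m2 : {sigma_finite_measure set T2 -> \bar R}) :
  sigma_finite setT (m1 \x m2)%E.
Proof.
have /sigma_finiteP[F [TF ndF Foo]] := sigma_finiteT m1.
have /sigma_finiteP[G [TG ndG Goo]] := sigma_finiteT m2.
exists (fun n => F n `*` G n).
  rewrite -setXTT TF TG predeqE => -[x y]; split.
    move=> [/= [n _ Fnx] [k _ Gky]]; exists (maxn n k) => //; split.
    - by move: x Fnx; exact/subsetPset/ndF/leq_maxl.
    - by move: y Gky; exact/subsetPset/ndG/leq_maxr.
  by move=> [n _ []/= ? ?]; split; exists n.
move=> k; have [? ?] := Foo k; have [? ?] := Goo k.
split; first exact: measurableX.
by rewrite product_measure1E// lte_mul_pinfty// ge0_fin_numE.
Qed.

Section lebesgue_tuple.
Context (R : realType).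
Local Notation T := (measurableTypeR R).

Definition tuple_consR n (p : T * n.-tuple T) : n.+1.-tuple T :=
  [tuple of p.1 :: p.2].

Lemma measurable_tuple_consR n : measurable_fun setT (@tuple_consR n).
Proof. exact: (measurable_cons measurable_fst measurable_snd). Qed.

Section succ.
Context (n : nat) (mu : {sigma_finite_measure set (n.-tuple T) -> \bar R}).

Definition lebesgue_tupleS : set (n.+1.-tuple T) -> \bar R :=
  pushforward (@lebesgue_measure R \x mu)%E (@tuple_consR n).

Let lebesgue_tupleS0 : lebesgue_tupleS set0 = 0%E.
Proof. by rewrite /lebesgue_tupleS /pushforward preimage_set0 measure0. Qed.

Let lebesgue_tupleS_ge0 A : (0 <= lebesgue_tupleS A)%E.
Proof. by rewrite /lebesgue_tupleS /pushforward; exact: measure_ge0. Qed.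

Let lebesgue_tupleS_sigma_additive : semi_sigma_additive lebesgue_tupleS.
Proof.
move=> F mF tF mUF; rewrite /lebesgue_tupleS /pushforward preimage_bigcup.
apply: measure_semi_sigma_additive.
- by move=> k; rewrite -[X in measurable X]setTI; exact: measurable_tuple_consR.
- by apply/trivIsetP => i j _ _ ij; rewrite -preimage_setI;
    move/trivIsetP : tF => -> //; rewrite preimage_set0.
- rewrite -preimage_bigcup -[X in measurable X]setTI.
  exact: measurable_tuple_consR.
Qed.

HB.instance Definition _ := isMeasure.Build _ _ _ lebesgue_tupleS
  lebesgue_tupleS0 lebesgue_tupleS_ge0 lebesgue_tupleS_sigma_additive.

Let lebesgue_tupleS_sigma_finite : sigma_finite setT lebesgue_tupleS.
Proof.
have [F FT mF] : sigma_finite setT (@lebesgue_measure R \x mu)%E.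
  exact: sigma_finite_product.
pose g (t : n.+1.-tuple T) : T * n.-tuple T := (thead t, [tuple of behead t]).
have gK : cancel (@tuple_consR n) g.
  by move=> [x t]; rewrite /g theadE; congr pair; exact: val_inj.
have mg : measurable_fun setT g.
  by apply/measurable_fun_pairP; split;
    [exact: measurable_tnth | exact: measurable_behead].
exists (fun k => g @^-1` F k).
  by rewrite -preimage_bigcup -FT preimage_setT.
move=> k; split.
  by rewrite -[X in measurable X]setTI; apply: mg => //; exact: (mF k).1.
rewrite /lebesgue_tupleS /pushforward -comp_preimage.
rewrite (_ : g \o _ = id); last by apply/funext => p /=; exact: gK.
exact: (mF k).2.
Qed.

HB.instance Definition _ := Measure_isSigmaFinite.Build _ _ _ lebesgue_tupleS
  lebesgue_tupleS_sigma_finite.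

End succ.

Fixpoint lebesgue_tuple n : {sigma_finite_measure set (n.-tuple T) -> \bar R} :=
  if n is n'.+1 then lebesgue_tupleS (lebesgue_tuple n')
  else \d_([tuple] : 0.-tuple T).

End lebesgue_tuple.

Lemma lebesgue_tuple_box (R : realType) n (A : 'I_n -> set (measurableTypeR R)) :
  (forall i, measurable (A i)) ->
  lebesgue_tuple R n [set t | forall i, A i (tnth t i)] =
  (\prod_(i < n) @lebesgue_measure R (A i))%E.
Proof.
elim: n A => [|n IH] A mA /=.
  rewrite big_ord0 diracE mem_set//=; by case.
rewrite /lebesgue_tupleS /pushforward.
rewrite (_ : _ @^-1` _ =
    A ord0 `*` [set t | forall i, A (lift ord0 i) (tnth t i)]).
  rewrite product_measure1E//=.
    by rewrite big_ord_recl; congr (_ * _)%E; exact: IH.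
  rewrite (_ : [set t | _] =
      \bigcap_(i in [set: 'I_n])
        (@tnth _ (measurableTypeR R) ^~ i @^-1` A (lift ord0 i))).
    apply: fin_bigcap_measurable => // i _.
    by rewrite -[X in measurable X]setTI; exact: measurable_tnth.
  by apply/seteqP; split => t /= H i; [move=> _; exact: H | exact: H].
apply/seteqP; split => -[x t] /= H.
  split; first by have := H ord0; rewrite tnth0.
  by move=> i; have := H (lift ord0 i); rewrite tnthS.
move=> i; case: (unliftP ord0 i) => [j ->|->]; last by rewrite tnth0; exact: H.1.
by rewrite tnthS; exact: H.2.
Qed.

Section calculus.
Context (R : realType) (N : nat).
Implicit Types (f g u phi : 'rV[R]_N -> R) (x : 'rV[R]_N).

(** The library norm on ['rV_N] is the sup norm. *)
Definition enorm x : R := Num.sqrt (\sum_(i < N) x 0 i ^+ 2).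

Definition partial (i : 'I_N) f : 'rV[R]_N -> R :=
  fun x => 'D_(delta_mx 0 i) f x.

Definition grad_sq f x : R := \sum_(i < N) partial i f x ^+ 2.

Definition laplacian f : 'rV[R]_N -> R :=
  fun x => \sum_(i < N) partial i (partial i f) x.

(** All iterated partial derivatives exist and are differentiable (hence
    continuous); this is equivalent to being of class C^oo. *)
Definition smooth f :=
  forall (s : seq 'I_N) x, differentiable (foldr partial f s) x.

Definition test_function phi :=
  smooth phi /\ compact (closure [set x | phi x != 0]).

Definition integralRN f : R :=
  \int[lebesgue_tuple R N]_t f (\row_i tnth t i).

(** Stability as defined for [m] odd, where [m.-1./2 = (m - 1) / 2]. *)
Definition stable_odd (m : nat) u :=
  forall phi, test_function phi ->
  0 <= integralRN (grad_sq (iter m.-1./2 laplacian phi))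
       - integralRN (fun x => expR (u x) * phi x ^+ 2).

(** [u x = U |x|].  The profile [U] is taken smooth on the whole line, so that
    its two-sided derivatives at [0] are the one-sided ones of [u(r)], [r >= 0];
    a smooth radial [u] always has such a profile, namely its restriction to a
    line through the origin. *)
Definition radial_profile u (U : R -> R) :=
  (forall (n : nat) (r : R), derivable (derive1n n U) r 1) /\
  (forall x, u x = U (enorm x)).

End calculus.

(* Main.v *)
Require Import Defs.
From HB Require Import structures.
From mathcomp Require Import all_boot all_order all_algebra.
From mathcomp Require Import ring lra zify.
From mathcomp Require Import all_classical all_reals all_analysis.
From mathcomp Require Import measurable_realfun.
Set Implicit Arguments.
Unset Strict Implicit.
Unset Printing Implicit Defensive.
Import Order.TTheory GRing.Theory Num.Theory.
Import numFieldNormedType.Exports.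
Local Open Scope classical_set_scope.
Local Open Scope ring_scope.

(** Write [w k] for the [k]-th iterated Laplacian of a radial function [u] on
    [R^N], [p = N - 1]. For odd [m] the equation says [w m = - exp u], hence it is
    equivalent to the integral equation [u = taylor p a (- exp u)], where
    [taylor] integrates the radial Laplacian [m] times with the data [a] at the
    origin.

    Existence. As [- exp u <= 0], every Picard iterate stays below the solution
    of the homogeneous equation, so that the exponential is Lipschitz along the
    iteration on each ball and the iteration converges on the whole space
    ([integral_equation_solution]).

    Smoothness. If [f' r = r * g r] then the radial function with profile [f] has
    partial derivatives [x_i] times the radial function with profile [g]
    ([rad_derive]), including at the origin. The profiles built from the [w k] by
    averages, sums and products form a set stable under [f |-> g]
    ([even_stable_profile_algebra]), so the solution is smooth ([smooth_rad]).

    Decay. If the data were [1, - A, 0, ..., 0], then all [w k] with [k >= 2] would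
    be nonpositive, the Laplacian would stay below [- A], and [u] below
    [1 - A * r ^ 2 / (2 * N)]. Replacing the zeros by data of alternating signs and
    tiny size [e] changes little: on the unit ball the source [- exp u] is bounded
    above by a negative constant that does not depend on [e], it pushes all these
    [w k] below zero by radius one, and from there on they remain nonpositive
    ([taylor_le0_past1], [decaying_solution_data]).

    Stability. With [weight = 1 / (eta + |x|^2)], the Hardy and Rellich
    inequalities bound the integral of [phi ^ 2 * weight ^ m] by that of
    [|grad (laplacian ^ ((m - 1) / 2) phi)| ^ 2] when [N > 2 * m], with constant one
    for every [eta > 0] ([hardy_rellich]). Each of them is a pointwise inequality
    up to the divergence of a compactly supported field, whose integral vanishes
    ([integralRN_partial]). So a solution with [exp u <= weight ^ m] is stable, and
    the Gaussian decay of [exp u] gives this bound once [A] is large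
    ([gaussian_le_weight]). *)

(** * One-variable calculus *)

Section one_variable.
Context (R : realType).
Implicit Types (f g h : R -> R) (r s x a b : R).

Lemma is_derive1D f g x a b : is_derive x 1 f a -> is_derive x 1 g b ->
  is_derive x 1 (fun y => f y + g y) (a + b).
Proof. exact: is_deriveD. Qed.

Lemma is_derive1B f g x a b : is_derive x 1 f a -> is_derive x 1 g b ->
  is_derive x 1 (fun y => f y - g y) (a - b).
Proof. exact: is_deriveB. Qed.

Lemma is_derive1M f g x a b : is_derive x 1 f a -> is_derive x 1 g b ->
  is_derive x 1 (fun y => f y * g y) (f x * b + a * g x).
Proof.
move=> fa gb; have := @is_deriveM _ _ f g x 1 a b fa gb.
by move=> /is_derive_eq; apply; rewrite ![_ *: _]/(_ * _) (mulrC a).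
Qed.

Lemma is_derive1_chain f g x a b :
  is_derive (g x) 1 f a -> is_derive x 1 g b ->
  is_derive x 1 (fun y => f (g y)) (a * b).
Proof. exact: is_derive1_comp. Qed.

Lemma is_derive1V f x a : f x != 0 -> is_derive x 1 f a ->
  is_derive x 1 (fun y => (f y)^-1) (- (f x) ^- 2 * a).
Proof. by move=> fx fa; have := is_deriveV fx fa. Qed.

Lemma is_derive1_idM0 f : continuous f ->
  is_derive (0 : R) 1 (fun y : R => y * f y) (f 0).
Proof.
move=> cf.
have H : (fun h : R => h^-1 *: ((fun y => y * f y) (h *: 1 + 0) -
    (fun y => y * f y) 0)) @ 0^' --> f 0.
  have : f h @[h --> 0^'] --> f 0 by apply: cvg_within_filter; exact: cf.
  apply: cvg_trans; apply: near_eq_cvg; near=> h.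
  have h0 : h != 0 by near: h; exact: nbhs_dnbhs_neq.
  by rewrite /GRing.scale /= mulr1 addr0 mul0r subr0 mulKf.
by apply: DeriveDef; [apply/cvg_ex; exists (f 0); exact: H|exact: cvg_lim H].
Unshelve. all: by end_near. Qed.

Lemma is_derive1X n x : is_derive x 1 (fun y : R => y ^+ n) (n%:R * x ^+ n.-1).
Proof.
have := @is_deriveX R R id n x 1 1 (is_derive_id x 1).
rewrite (_ : id ^+ n = fun y => y ^+ n); last first.
  by apply/funext => y; elim: n => [|n IH]; rewrite ?expr0// !exprS -IH.
by move=> H; apply: (is_derive_eq H); rewrite scaler1 mulr_natl.
Qed.

Lemma is_derive1Mr c x : is_derive x 1 (fun y : R => y * c) c.
Proof.
have := is_derive1M (is_derive_id x 1) (is_derive_cst c x 1).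
by rewrite /= mulr0 add0r mul1r.
Qed.

Lemma is_derive1_continuous f x a : is_derive x 1 f a -> {for x, continuous f}.
Proof. by move=> [df _]; exact/differentiable_continuous/derivable1_diffP. Qed.

Lemma continuous1M f g : continuous f -> continuous g ->
  continuous (fun x => f x * g x).
Proof. by move=> cf cg x; apply: cvgM; [exact: cf|exact: cg]. Qed.

Lemma continuous1D f g : continuous f -> continuous g ->
  continuous (fun x => f x + g x).
Proof. by move=> cf cg x; apply: cvgD; [exact: cf|exact: cg]. Qed.

Lemma continuous1N f : continuous f -> continuous (fun x => - f x).
Proof. by move=> cf x; apply: cvgN; exact: cf. Qed.

Lemma continuous1B f g : continuous f -> continuous g ->
  continuous (fun x => f x - g x).
Proof. by move=> cf cg x; apply: cvgB; [exact: cf|exact: cg]. Qed.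

Lemma continuous1X n : continuous (fun x : R => x ^+ n).
Proof. by move=> x; exact: is_derive1_continuous (is_derive1X n x). Qed.

Lemma is_derive1_sqrM0 f : continuous f ->
  is_derive (0 : R) 1 (fun y : R => y ^+ 2 * f y) 0.
Proof.
move=> cf; have cyf : continuous (fun y : R => y * f y).
  by apply: continuous1M => // x; exact: cvg_id.
have := is_derive1_idM0 cyf; rewrite mul0r.
by under eq_fun do rewrite mulrA -expr2.
Qed.

Lemma continuous1_cst a : continuous (fun _ : R => a).
Proof. by move=> x; exact: cvg_cst. Qed.

Lemma continuous1_comp f g : continuous f -> continuous g ->
  continuous (fun x => f (g x)).
Proof.
by move=> cf cg x; apply: (@continuous_comp _ _ _ g f); [exact: cg|exact: cf].
Qed.

Lemma continuous1_expR f : continuous f -> continuous (fun x => expR (f x)).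
Proof. by apply: continuous1_comp; exact: continuous_expR. Qed.

Lemma continuous_bounded f (L : R) : continuous f ->
  exists2 M, 0 <= M & forall s, `|s| <= L -> `|f s| <= M.
Proof.
move=> cf; have [L0|L0] := leP 0 L; last first.
  by exists 0 => // s sL; have := le_lt_trans (le_trans (normr_ge0 s) sL) L0; rewrite ltxx.
have LL : - L <= L by rewrite (le_trans _ L0)// oppr_le0.
have cnf : {within `[- L, L], continuous (fun x => `|f x|)}.
  apply: continuous_subspaceT => x; apply: (@continuous_comp _ _ _ f Num.norm).
    exact: cf.
  exact: norm_continuous.
have [c _ cM] := EVT_max LL cnf.
by exists `|f c| => // s sL; apply: cM; rewrite in_itv /= -ler_norml.
Qed.

(** * Averages of a function over the segments issued from the origin *)

Local Notation I01 h := (Rintegral (@lebesgue_measure R) `[0, 1] h).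

Lemma integrable01 h : continuous h ->
  (@lebesgue_measure R).-integrable `[0, 1] (EFin \o h).
Proof.
move=> ch; apply: continuous_compact_integrable; first exact: segment_compact.
exact: continuous_subspaceT.
Qed.

Lemma FTC2_01 (F h : R -> R) : continuous h ->
  (forall t : R, 0 <= t <= 1 -> is_derive t 1 F (h t)) -> I01 h = F 1 - F 0.
Proof.
move=> ch dF; have cF t : 0 <= t <= 1 -> {for t, continuous F}.
  by move=> t01; exact: is_derive1_continuous (dF _ t01).
have oc t : t \in `]0, 1[ -> 0 <= t <= 1.
  by rewrite in_itv /= => /andP[/ltW -> /ltW].
rewrite /Rintegral (@continuous_FTC2 _ h F)//.
- exact: continuous_subspaceT.
- split.
  + by move=> t /oc t01; case: (dF _ t01).
  + by apply: cvg_at_right_filter; apply: cF; rewrite lexx ler01.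
  + by apply: cvg_at_left_filter; apply: cF; rewrite lexx ler01.
- by move=> t /oc t01; rewrite derive1E; case: (dF _ t01).
Qed.

(** For [r > 0] this is [r ^ (- (p + 1))] times the integral of [t ^ p * f t]
    over [[0, r]]; the rescaling to the unit segment gives a formula that also
    makes sense for [r <= 0]. *)
Definition avg (p : nat) f r := I01 (fun t => t ^+ p * f (t * r)).

Lemma continuous_avg_integrand p f r : continuous f ->
  continuous (fun t : R => t ^+ p * f (t * r)).
Proof.
move=> cf; apply: continuous1M; first exact: continuous1X.
apply: (@continuous1_comp f) => // t.
exact: is_derive1_continuous (is_derive1Mr r t).
Qed.

Lemma avgD p f g r : continuous f -> continuous g ->
  avg p (fun x => f x + g x) r = avg p f r + avg p g r.
Proof.
move=> cf cg; rewrite /avg -RintegralD//;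
  try by apply: integrable01; exact: continuous_avg_integrand.
by apply: eq_Rintegral => t _; rewrite mulrDr.
Qed.

Lemma avgZ p c f r : continuous f -> avg p (fun x => c * f x) r = c * avg p f r.
Proof.
move=> cf; rewrite /avg -RintegralZl//;
  last by apply: integrable01; exact: continuous_avg_integrand.
by apply: eq_Rintegral => t _; rewrite mulrCA.
Qed.

Lemma le_avg p f g r : continuous f -> continuous g ->
  (forall t, 0 <= t <= 1 -> f (t * r) <= g (t * r)) -> avg p f r <= avg p g r.
Proof.
move=> cf cg fg; apply: le_Rintegral => //;
  try by apply: integrable01; exact: continuous_avg_integrand.
move=> t /=; rewrite in_itv /= => t01; have /andP[t0 _] := t01.
by rewrite ler_wpM2l ?exprn_ge0//; exact: fg.
Qed.

Lemma avg_monomial p n c r :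
  avg p (fun x => c * x ^+ n) r = c * r ^+ n / (p + n).+1%:R.
Proof.
rewrite /avg (_ : (fun t => _) = fun t => t ^+ (p + n) * (c * r ^+ n)); last first.
  by apply/funext => t; rewrite exprMn exprD; ring.
pose C := c * r ^+ n / (p + n).+1%:R.
have dF (t : R) : is_derive t 1 (fun t => t ^+ (p + n).+1 * C)
    (t ^+ (p + n) * (c * r ^+ n)).
  have := is_derive1M (is_derive1X (p + n).+1 t) (is_derive_cst C t 1).
  rewrite /= mulr0 add0r => /is_derive_eq; apply.
  by rewrite /C; field; rewrite ?pnatr_eq0.
rewrite (FTC2_01 _ (fun t _ => dF t)); first by rewrite expr1n mul1r exprS !mul0r subr0.
by apply: continuous1M; [exact: continuous1X|exact: continuous1_cst].
Qed.

Lemma avg0 p f : avg p f 0 = f 0 / p.+1%:R.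
Proof.
have := avg_monomial p 0 (f 0) 0; rewrite expr0 mulr1 addn0 => <-.
by rewrite /avg; apply: eq_Rintegral => t _; rewrite mulr0.
Qed.

(** Every continuous function on the line has, on each bounded interval, a
    primitive; pulled back along the segment from the origin to [r], it computes
    the average at [r], whatever the sign of [r]. *)
Lemma is_derive_exprM_avg p h r : continuous h ->
  is_derive r 1 (fun s => s ^+ p.+1 * avg p h s) (r ^+ p * h r).
Proof.
move=> ch; pose k s := s ^+ p * h s.
have ck : continuous k by apply: continuous1M => //; exact: continuous1X.
pose L : R := `|r| + 1.
have rL : `|r| < L by rewrite ltrDl.
pose F (x : R) := \int[@lebesgue_measure R]_(t in `[- (L + 1), x]) k t.
have dF s : `|s| <= L -> is_derive s 1 F (k s).
  move=> sL; have sL1 : s < L + 1.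
    by rewrite (le_lt_trans (ler_norm s))// (le_lt_trans sL)// ltrDl.
  have Ls : - (L + 1) < s.
    by rewrite ltrNl (le_lt_trans (ler_norm _))// normrN (le_lt_trans sL)// ltrDl.
  have [] := @continuous_FTC1_closed R k (- (L + 1)) s (L + 1) sL1 _ Ls (ck s).
    apply: continuous_compact_integrable; first exact: segment_compact.
    exact: continuous_subspaceT.
  by move=> D E; apply: (DeriveDef D); rewrite -derive1E; exact: E.
have E s : `|s| <= L -> s ^+ p.+1 * avg p h s = F s - F 0.
  have [->|s0] := eqVneq s 0; first by rewrite expr0n mul0r subrr.
  move=> sL; have ct : continuous (fun t : R => t ^+ p * h (t * s)).
    exact: continuous_avg_integrand.
  have d (t : R) : 0 <= t <= 1 -> is_derive t 1 (fun t => F (t * s))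
      (s ^+ p.+1 * (t ^+ p * h (t * s))).
    move=> /andP[t0 t1].
    have tsL : `|t * s| <= L by rewrite normrM ger0_norm// (le_trans _ sL)// ler_piMl.
    have := @is_derive1_chain F (fun y => y * s) t _ _ (dF _ tsL) (is_derive1Mr s t).
    by move/is_derive_eq; apply; rewrite /k exprMn exprS; ring.
  have cc : continuous (fun t : R => s ^+ p.+1 * (t ^+ p * h (t * s))).
    by apply: continuous1M => //; exact: continuous1_cst.
  by have := FTC2_01 cc d; rewrite mul1r mul0r => <-; rewrite RintegralZl//;
    exact: integrable01.
apply: (@near_eq_is_derive _ _ _ (fun s => F s - F 0)); rewrite ?oner_eq0//.
  have rn : (fun s : R => `|s|) @ r --> `|r| by exact: norm_continuous.
  near=> s; rewrite E//; apply: ltW; near: s.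
  exact: (cvgr_lt _ rn).
rewrite -[r ^+ p * h r]subr0; apply: is_derive1B; first exact: dF (ltW rL).
Unshelve. all: by end_near. Qed.

(** Dominated convergence: on a bounded set of radii the integrands share a
    constant bound. *)
Lemma continuous_avg p h : continuous h -> continuous (avg p h).
Proof.
move=> ch r; have [M M0 hM] := continuous_bounded (`|r| + 1) ch.
have rI : r \in `]r - 1, r + 1[%classic.
  by rewrite inE/= in_itv /=; apply/andP; split; lra.
have := @continuity_under_integral R _ _ (@lebesgue_measure R)
  (fun s t => t ^+ p * h (t * s)) `[0, 1] _ (r - 1) (r + 1) _ _ (fun _ => M) _ _ r rI.
apply => //.
- by move=> s _; apply: integrable01; exact: continuous_avg_integrand.
- apply: aeW => t _ s _; apply: continuous1M; first exact: continuous1_cst.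
  apply: (@continuous1_comp h) => // y.
  have := is_derive1Mr t y; rewrite (_ : (fun y => _) = ( *%R t)).
    by move/is_derive1_continuous.
  by apply/funext => z; rewrite mulrC.
- by apply: integrable01; exact: continuous1_cst.
- move=> s /=; rewrite in_itv /= => /andP[s1 s2]; apply: aeW => t /=.
  rewrite in_itv /= => /andP[t0 t1]; rewrite normrM -[leRHS]mul1r ler_pM//.
    by rewrite normrX ger0_norm// exprn_ile1.
  apply: hM; rewrite normrM ger0_norm//; apply: (@le_trans _ _ `|s|).
    by rewrite ler_piMl.
  rewrite -lerBlDl; apply: (le_trans (lerB_dist _ _)).
  by rewrite ler_norml; lra.
Qed.

(** Both sides vanish at the origin and have the same derivative. *)
Lemma avg1_primitive f g r : continuous g ->
  (forall s : R, is_derive s 1 f (s * g s)) ->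
  r ^+ 2 * avg 1 g r = f r - f 0.
Proof.
move=> cg df.
have H s : is_derive s 1 (fun s => s ^+ 2 * avg 1 g s - f s) 0.
  have := is_derive1B (is_derive_exprM_avg 1 s cg) (df s).
  by move/is_derive_eq; apply; rewrite expr1 subrr.
have := is_derive_0_is_cst r 0 H; rewrite expr0n /= mul0r sub0r => /eqP.
by rewrite subr_eq addrC => /eqP.
Qed.

(** Integrate by parts [t ^ p * f (t * r)] on the unit segment. In dimension
    [p + 1] this reads [laplacian (invlap f) = f], since the radial Laplacian of
    [u] with [u' r = r * v r] is [(p + 1) * v r + r * v' r]. *)
Lemma avg_by_parts p f g r : continuous f -> continuous g ->
  (forall s : R, is_derive s 1 f (s * g s)) ->
  p.+1%:R * avg p f r + r ^+ 2 * avg p.+2 g r = f r.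
Proof.
move=> cf cg df.
rewrite /avg -!RintegralZl//; try by apply: integrable01; exact: continuous_avg_integrand.
rewrite -RintegralD//; last 2 first.
- apply: integrable01; apply: continuous1M; first exact: continuous1_cst.
  exact: continuous_avg_integrand.
- apply: integrable01; apply: continuous1M; first exact: continuous1_cst.
  exact: continuous_avg_integrand.
have d (t : R) : 0 <= t <= 1 -> is_derive t 1 (fun t => t ^+ p.+1 * f (t * r))
    (p.+1%:R * (t ^+ p * f (t * r)) + r ^+ 2 * (t ^+ p.+2 * g (t * r))).
  move=> _; have := is_derive1M (is_derive1X p.+1 t)
    (@is_derive1_chain f (fun y => y * r) t _ _ (df _) (is_derive1Mr r t)).
  by move/is_derive_eq; apply; rewrite /= !exprS; ring.
rewrite (FTC2_01 _ d); first by rewrite expr1n !mul1r exprS !mul0r subr0.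
by apply: continuous1D; apply: continuous1M;
  [exact: continuous1_cst|exact: continuous_avg_integrand
  |exact: continuous1_cst|exact: continuous_avg_integrand].
Qed.

(** Off the origin the derivative of the average follows from
    [is_derive_exprM_avg]; at the origin the integration by parts exhibits the
    average as [f] minus a term of order two. *)
Lemma is_derive_avg p f g r : continuous f -> continuous g ->
  (forall s : R, is_derive s 1 f (s * g s)) ->
  is_derive r 1 (avg p f) (r * avg p.+2 g r).
Proof.
move=> cf cg df; have p0 : p.+1%:R != 0 :> R by rewrite pnatr_eq0.
have cA : continuous (avg p.+2 g) by exact: continuous_avg.
have [->|r0] := eqVneq r 0.
  have E : avg p f = fun s => (f s - s ^+ 2 * avg p.+2 g s) * p.+1%:R^-1.
    by apply/funext => s; rewrite -[in RHS](avg_by_parts p s cf cg df); field.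
  rewrite E; have := is_derive1M (is_derive1B (df 0) (is_derive1_sqrM0 cA))
    (is_derive_cst (p.+1%:R^-1 : R) (0 : R) 1).
  by move/is_derive_eq; apply; field.
have q0 : r ^+ p != 0 by rewrite expf_neq0.
have ri : is_derive r 1 (fun s : R => (s ^+ p.+1)^-1) (- p.+1%:R * (r ^+ p.+2)^-1).
  have := @is_derive1V (fun s => s ^+ p.+1) r _ (expf_neq0 p.+1 r0) (is_derive1X p.+1 r).
  by move/is_derive_eq; apply; rewrite /= !exprS; field; rewrite r0 q0.
have := is_derive1M (is_derive_exprM_avg p r cf) ri.
have -> : r ^+ p.+1 * avg p f r * (- p.+1%:R * (r ^+ p.+2)^-1) +
    r ^+ p * f r * (r ^+ p.+1)^-1 = r * avg p.+2 g r.
  by rewrite -(avg_by_parts p r cf cg df) !exprS; field; rewrite r0 q0.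
apply: near_eq_is_derive; rewrite ?oner_eq0//.
near=> s; rewrite mulrAC mulfV ?mul1r// expf_neq0//.
by near: s; exact: (@cvgr_neq0 _ _ _ _ _ id r).
Unshelve. all: by end_near. Qed.

End one_variable.

Opaque avg.

(** * The radial inverse Laplacian and the integral equation *)

Section integral_equation.
Context (R : realType) (p : nat).
Implicit Types (f g h : R -> R) (r s c l k : R) (a : seq R).

(** In dimension [p + 1], the radial function with Laplacian [f] that vanishes at
    the origin: its derivative at [r > 0] is [r * avg p f r], that is [r ^ (- p)]
    times the integral of [t ^ p * f t] over [[0, r]]. *)
Definition invlap f r := r ^+ 2 * avg 1 (avg p f) r.

Lemma continuous_invlap f : continuous f -> continuous (invlap f).
Proof.
move=> cf; apply: continuous1M; first exact: continuous1X.
by do 2 apply: continuous_avg.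
Qed.

Lemma is_derive_invlap f r : continuous f ->
  is_derive r 1 (invlap f) (r * avg p f r).
Proof.
move=> cf; have := is_derive_exprM_avg 1 r (@continuous_avg R p f cf).
by rewrite expr1.
Qed.

Lemma is_derive_cst_invlap c f r : continuous f ->
  is_derive r 1 (fun s => c + invlap f s) (r * avg p f r).
Proof.
move=> cf; have := is_derive1D (is_derive_cst c r 1) (is_derive_invlap r cf).
by rewrite add0r.
Qed.

Lemma invlap0 f : invlap f 0 = 0.
Proof. by rewrite /invlap expr0n mul0r. Qed.

Lemma invlapD f g r : continuous f -> continuous g ->
  invlap (fun x => f x + g x) r = invlap f r + invlap g r.
Proof.
move=> cf cg; rewrite /invlap -mulrDr -avgD; try exact: continuous_avg.
have -> // : avg p (fun x => f x + g x) = fun s => avg p f s + avg p g s.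
by apply/funext => s; rewrite avgD.
Qed.

Lemma invlapZ c f r : continuous f -> invlap (fun x => c * f x) r = c * invlap f r.
Proof.
move=> cf; rewrite /invlap mulrCA -(@avgZ R 1 c); last exact: continuous_avg.
have -> // : avg p (fun x => c * f x) = fun s => c * avg p f s.
by apply/funext => s; rewrite avgZ.
Qed.

Lemma invlapB f g r : continuous f -> continuous g ->
  invlap (fun x => f x - g x) r = invlap f r - invlap g r.
Proof.
move=> cf cg.
have -> : (fun x => f x - g x) = (fun x => f x + -1 * g x).
  by apply/funext => s; rewrite mulN1r.
rewrite invlapD ?invlapZ ?mulN1r//.
by apply: continuous1M => //; exact: continuous1_cst.
Qed.

Lemma le_invlap f g r : continuous f -> continuous g ->
  (forall t, 0 <= t <= 1 -> f (t * r) <= g (t * r)) -> invlap f r <= invlap g r.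
Proof.
move=> cf cg fg; apply: ler_wpM2l; first exact: sqr_ge0.
apply: le_avg; [exact: continuous_avg..|].
move=> t /andP[t0 t1]; apply: le_avg => // s /andP[s0 s1].
by rewrite mulrA fg// mulr_ge0//= mulr_ile1.
Qed.

Lemma invlap_monomial n c r :
  invlap (fun x => c * x ^+ n) r =
  c / ((p + n).+1%:R * n.+2%:R) * r ^+ n.+2.
Proof.
rewrite /invlap (_ : avg p _ = fun x => (c / (p + n).+1%:R) * x ^+ n); last first.
  by apply/funext => s; rewrite avg_monomial mulrAC.
rewrite avg_monomial add1n !exprS.
have A0 : (p + n).+1%:R != 0 :> R by rewrite pnatr_eq0.
have B0 : n.+2%:R != 0 :> R by rewrite pnatr_eq0.
by move: (p + n).+1%:R n.+2%:R A0 B0 => A B A0 B0; field; rewrite A0 B0.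
Qed.

Lemma invlap_cst c r : invlap (fun _ => c) r = c / (p.+1%:R * 2) * r ^+ 2.
Proof.
have -> : (fun _ => c) = (fun x : R => c * x ^+ 0).
  by apply/funext => x; rewrite mulr1.
by rewrite invlap_monomial addn0.
Qed.

(** Gaussian weights [exp (l * r ^ 2)] make the inverse Laplacian as small as
    desired: this is what turns the integral equation into a contraction on
    each ball. *)
Definition gauss l r := expR (l * r ^+ 2).

Lemma continuous_gauss l : continuous (gauss l).
Proof.
apply: continuous1_expR; apply: continuous1M; first exact: continuous1_cst.
exact: continuous1X.
Qed.

Lemma gauss_ge1 l r : 0 <= l -> 1 <= gauss l r.
Proof.
by move=> l0; rewrite (le_trans _ (expR_ge1Dx _))// lerDl mulr_ge0// sqr_ge0.
Qed.

Lemma le_gauss l r s : 0 <= l -> `|r| <= `|s| -> gauss l r <= gauss l s.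
Proof.
move=> l0 rs; rewrite ler_expR ler_wpM2l//.
by rewrite -(real_normK (num_real r)) -(real_normK (num_real s)) ler_sqr ?nnegrE.
Qed.

Lemma invlap_gauss_le l r : 0 < l ->
  invlap (gauss l) r <= (2 * l * p.+1%:R)^-1 * gauss l r.
Proof.
move=> l0; have l1 := ltW l0; have cg := @continuous_gauss l.
have cA : continuous (avg p (gauss l)) by exact: continuous_avg.
pose g s := 2 * l * gauss l s.
have dg (s : R) : is_derive s 1 (gauss l) (s * g s).
  have d2 : is_derive s 1 (fun x => l * x ^+ 2) (2 * l * s).
    have := is_derive1M (is_derive_cst l s 1) (is_derive1X 2 s).
    by move/is_derive_eq; apply => /=; ring.
  have := @is_derive1_chain R expR (fun x => l * x ^+ 2) s _ _ (is_derive_expR (l * s ^+ 2)) d2.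
  by move/is_derive_eq; apply; rewrite /g /gauss; ring.
have cgg : continuous g by apply: continuous1M => //; exact: continuous1_cst.
have step s : avg p (gauss l) s <= (2 * l * p.+1%:R)^-1 * g s.
  have /le_trans : avg p (gauss l) s <= avg p (fun x => gauss l s * x ^+ 0) s.
    apply: le_avg => //.
      by apply: continuous1M; [exact: continuous1_cst|exact: continuous1X].
    move=> t /andP[t0 t1]; rewrite expr0 mulr1 le_gauss// normrM ger0_norm//.
    by rewrite ler_piMl.
  apply; rewrite avg_monomial addn0 /g le_eqVlt; apply/orP; left; apply/eqP.
  have P0 : p.+1%:R != 0 :> R by rewrite pnatr_eq0.
  rewrite expr0; move: p.+1%:R P0 => P P0; field.
  by rewrite P0 gt_eqF.
have : r ^+ 2 * avg 1 (avg p (gauss l)) r <= r ^+ 2 * avg 1 (fun s => (2 * l * p.+1%:R)^-1 * g s) r.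
  apply: ler_wpM2l; first exact: sqr_ge0.
  apply: le_avg => //.
  by apply: continuous1M => //; exact: continuous1_cst.
move/le_trans; apply; rewrite avgZ// mulrCA (avg1_primitive _ cgg dg).
rewrite ler_wpM2l ?invr_ge0 ?mulr_ge0// gerBl.
exact: expR_ge0.
Qed.

Opaque invlap.

(** [taylor a f] is the radial function whose [size a]-fold Laplacian is [f] and
    whose iterated Laplacians at the origin are the entries of [a]. *)
Definition taylor (a : seq R) f := foldr (fun c w r => c + invlap w r) f a.

Lemma continuous_taylor a f : continuous f -> continuous (taylor a f).
Proof.
move=> cf; elim: a => [//|c a IH]; apply: continuous1D.
  exact: continuous1_cst.
exact: continuous_invlap.
Qed.

Lemma le_taylor a f g r : continuous f -> continuous g ->
  (forall t, 0 <= t <= 1 -> f (t * r) <= g (t * r)) ->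
  taylor a f r <= taylor a g r.
Proof.
move=> cf cg; elim: a r => [|c a IH] r fg /=.
  by have := fg 1; rewrite mul1r lexx ler01; exact.
rewrite lerD2l; apply: le_invlap; [exact: continuous_taylor..|].
move=> t /andP[t0 t1]; apply: IH => s /andP[s0 s1].
by rewrite mulrA fg// mulr_ge0//= mulr_ile1.
Qed.

(** The difference of the two functions is an iterated inverse Laplacian of [f - g],
    and each inverse Laplacian costs the factor of [invlap_gauss_le]. *)
Lemma taylor_contraction a f g l c r : 0 < l -> 0 <= c ->
  continuous f -> continuous g ->
  (forall t, 0 <= t <= 1 -> `|f (t * r) - g (t * r)| <= c * gauss l (t * r)) ->
  `|taylor a f r - taylor a g r| <=
    c * (2 * l * p.+1%:R)^-1 ^+ size a * gauss l r.
Proof.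
move=> l0 c0 cf cg; elim: a r => [|b a IH] r fg /=.
  by have := fg 1; rewrite mul1r mulr1 lexx ler01; exact.
rewrite opprD addrACA subrr add0r.
have cF := @continuous_taylor a f cf; have cG := @continuous_taylor a g cg.
set k := (2 * l * p.+1%:R)^-1.
have k0 : 0 <= k by rewrite invr_ge0 !mulr_ge0// ltW.
have ch : continuous (fun s => (c * k ^+ size a) * gauss l s).
  by apply: continuous1M; [exact: continuous1_cst|exact: continuous_gauss].
have H t : 0 <= t <= 1 -> `|taylor a f (t * r) - taylor a g (t * r)| <=
    (c * k ^+ size a) * gauss l (t * r).
  move=> /andP[t0 t1]; apply: IH => s /andP[s0 s1].
  by rewrite mulrA fg// mulr_ge0//= mulr_ile1.
rewrite -invlapB//.
have E : c * k ^+ (size a).+1 * gauss l r = (c * k ^+ size a) * (k * gauss l r).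
  by rewrite exprS; ring.
have B : invlap (fun s => (c * k ^+ size a) * gauss l s) r <= c * k ^+ (size a).+1 * gauss l r.
  rewrite invlapZ; last exact: continuous_gauss.
  rewrite E ler_wpM2l//; first by rewrite mulr_ge0// exprn_ge0.
  exact: invlap_gauss_le.
rewrite ler_norml; apply/andP; split.
- rewrite lerNl -mulN1r -invlapZ; last exact: continuous1B.
  apply: le_trans B; apply: le_invlap => //.
    by apply: continuous1M; [exact: continuous1_cst|exact: continuous1B].
  move=> t t01; apply: le_trans (H t t01); rewrite mulN1r.
  by rewrite (le_trans (ler_norm _))// normrN.
- apply: le_trans B; apply: le_invlap => //; first exact: continuous1B.
  by move=> t t01; apply: le_trans (H t t01); exact: ler_norm.
Qed.

Lemma expR_lip (a b : R) k : a <= k -> b <= k -> `|expR a - expR b| <= expR k * `|a - b|.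
Proof.
wlog ab : a b / b <= a.
  move=> H ak bk; have [/H|/ltW/H] := leP b a; first exact.
  by rewrite distrC (distrC a); exact.
move=> ak bk; rewrite !ger0_norm ?subr_ge0 ?ler_expR//.
have -> : expR a - expR b = expR a * (1 - expR (b - a)).
  by rewrite mulrBr mulr1 -expRD [a + _]addrC subrK.
apply: (@le_trans _ _ (expR a * (a - b))).
  rewrite ler_wpM2l ?expR_ge0// lerBlDr -lerBlDl.
  by rewrite (le_trans _ (expR_ge1Dx _))//; lra.
by rewrite ler_wpM2r ?subr_ge0// ler_expR.
Qed.

(** [u n -/+ 2 * M / 2 ^ n] are monotone sequences that enclose the limit. *)
Lemma geometric_cauchy (u : R^nat) M :
  (forall n, `|u n.+1 - u n| <= M * 2^-1 ^+ n) ->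
  forall n, `|limn u - u n| <= 2 * M * 2^-1 ^+ n.
Proof.
move=> uM; have M0 : 0 <= M by rewrite (le_trans (normr_ge0 _) (le_trans (uM 0) _))// mulr1.
pose v n := u n - 2 * M * 2^-1 ^+ n.
pose w n := u n + 2 * M * 2^-1 ^+ n.
have h0 n : 0 <= 2 * M * 2^-1 ^+ n by rewrite !mulr_ge0// exprn_ge0// invr_ge0.
have eh n : 2 * M * 2^-1 ^+ n.+1 = M * 2^-1 ^+ n by rewrite exprS; field.
have vS n : v n <= v n.+1.
  have := uM n; rewrite ler_norml => /andP[+ _].
  rewrite /v eh; set q := M * _; have -> : 2 * M * 2^-1 ^+ n = 2 * q by rewrite mulrA.
  by lra.
have wS n : w n.+1 <= w n.
  have := uM n; rewrite ler_norml => /andP[_].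
  rewrite /w eh; set q := M * _; have -> : 2 * M * 2^-1 ^+ n = 2 * q by rewrite mulrA.
  by lra.
have vh : {homo v : n m / (n <= m)%N >-> n <= m} by apply: homo_leq => // ? ? ?; exact: le_trans.
have wh : {homo w : n m / (n <= m)%N >-> n >= m}.
  by apply: (@homo_leq _ w (fun x y => y <= x)) => // x y z xy yz; exact: le_trans yz xy.
have vw m n : v m <= w n.
  apply: (@le_trans _ _ (v (maxn m n))); first by apply: vh; exact: leq_maxl.
  apply: (@le_trans _ _ (w (maxn m n))); last by apply: wh; exact: leq_maxr.
  by rewrite lerD2l (@le_trans _ _ 0)// oppr_le0.
have cv : cvgn v by apply: nondecreasing_is_cvgn => //; exists (w 0) => _ [n _ <-].
have c0 : (fun n => 2 * M * 2^-1 ^+ n) @ \oo --> (0 : R).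
  rewrite -[X in _ --> X](mulr0 (2 * M)); apply: cvgMr.
  by apply: cvg_expr; rewrite ger0_norm// invf_lt1// ltr1n.
have uv : limn u = limn v.
  apply/cvg_lim => //; rewrite -[X in _ --> X]addr0.
  rewrite (_ : u = (fun n => v n + 2 * M * 2^-1 ^+ n)); last first.
    by apply/funext => n; rewrite subrK.
  exact: cvgD cv c0.
move=> n; rewrite uv ler_norml; apply/andP; split.
  rewrite lerBrDr addrC; apply: limr_ge => //; exists n => // k /= nk.
  by apply: le_trans (vh _ _ nk).
rewrite lerBlDr addrC; apply: limr_le => //; apply: nearW => k; exact: vw.
Qed.

Lemma small_geometric (C e : R) : 0 < e -> exists n, C * 2^-1 ^+ n < e.
Proof.
move=> e0; have [n nC] : exists n : nat, C / e < n%:R.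
  exists (Num.bound `|C / e|); rewrite (le_lt_trans (ler_norm _))//.
  exact: archi_boundP.
exists n; rewrite exprVn ltr_pdivrMr ?exprn_gt0// mulrC -ltr_pdivrMr//.
by rewrite (lt_le_trans nC)// -natrX ler_nat ltnW// ltn_expl.
Qed.

(** Picard iteration from the solution [taylor a 0] of the homogeneous equation.
    All iterates stay below it, so that the exponential is Lipschitz along the
    iteration on each ball, and a Gaussian weight makes each step contract by
    one half there. *)
Theorem integral_equation_solution a : (0 < size a)%N ->
  exists2 u : R -> R, continuous u & u = taylor a (fun r => - expR (u r)).
Proof.
move=> a0; have half_ge0 n : 0 <= 2^-1 ^+ n :> R by rewrite exprn_ge0// invr_ge0.
pose T f := taylor a (fun r => - expR (f r)).
pose u0 := taylor a (fun _ => 0).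
pose u n := iter n T u0.
have cu0 : continuous u0 by apply: continuous_taylor; exact: continuous1_cst.
have cNe f : continuous f -> continuous (fun r => - expR (f r)).
  by move=> cf; apply: continuous1N; exact: continuous1_expR.
have cT f : continuous f -> continuous (T f).
  by move=> cf; apply: continuous_taylor; exact: cNe.
have cu n : continuous (u n) by elim: n => [//|n IH]; exact: cT.
have ule n r : u n r <= u0 r.
  case: n => [//|n]; apply: le_taylor; [exact: cNe|exact: continuous1_cst|].
  by move=> t _; rewrite oppr_le0 expR_ge0.
pose U r := limn (fun n => u n r).
(* On a ball, [k] bounds all iterates and [l] makes the contraction factor of
   [taylor_contraction] times the Lipschitz constant [expR k] at most one half. *)
have local L : exists l k M, [/\ 0 < l, 0 <= M,
    expR k * (2 * l * p.+1%:R)^-1 ^+ size a <= 2^-1,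
    forall r, `|r| <= L -> u0 r <= k &
    forall r n, `|r| <= L -> `|U r - u n r| <= M * 2^-1 ^+ n].
  have [k k0 u0k] := continuous_bounded L cu0.
  have [D D0 uD] := continuous_bounded L (continuous1B (cu 1%N) (cu 0%N)).
  pose l := expR k / p.+1%:R.
  have l0 : 0 < l by rewrite divr_gt0// expR_gt0.
  have kap : (2 * l * p.+1%:R)^-1 = (2 * expR k)^-1.
    by rewrite /l -mulrA divfK// pnatr_eq0.
  have ek1 : 1 <= expR k by rewrite -expR0 ler_expR.
  have half : expR k * (2 * l * p.+1%:R)^-1 ^+ size a <= 2^-1.
    rewrite kap; case: (size a) a0 => // n _.
    rewrite exprS invfM mulrA mulrCA mulfV ?gt_eqF ?expR_gt0// mulr1.
    have e1 : (2 * expR k)^-1 <= 1 by rewrite invf_le1; lra.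
    rewrite -invfM; apply: ler_piMr; first by rewrite invr_ge0.
    by apply: exprn_ile1 => //; rewrite invr_ge0 mulr_ge0// expR_ge0.
  have uk n r : `|r| <= L -> u n r <= k.
    by move=> rL; rewrite (le_trans (ule n r))// (le_trans (ler_norm _))// u0k.
  have step n r : `|r| <= L -> `|u n.+1 r - u n r| <= D * 2^-1 ^+ n * gauss l r.
    elim: n r => [|n IH] r rL.
      rewrite expr0 mulr1 (le_trans (uD _ rL))// ler_peMr// gauss_ge1//.
      exact: ltW.
    have [c0 cN1 cN2] : [/\ 0 <= expR k * (D * 2^-1 ^+ n),
        continuous (fun r => - expR (u n.+1 r)) &
        continuous (fun r => - expR (u n r))].
      split; [|exact: cNe..].
      by apply: mulr_ge0; [exact: expR_ge0|exact: mulr_ge0].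
    change (`|taylor a (fun r => - expR (u n.+1 r)) r -
      taylor a (fun r => - expR (u n r)) r| <= D * 2^-1 ^+ n.+1 * gauss l r).
    apply: (le_trans (taylor_contraction a l0 c0 cN1 cN2 _)).
      move=> t /andP[t0 t1].
      have trL : `|t * r| <= L by rewrite normrM ger0_norm// (le_trans _ rL)// ler_piMl.
      rewrite -opprD normrN -mulrA.
      apply: (le_trans (expR_lip (uk n.+1 _ trL) (uk n _ trL))).
      by rewrite ler_wpM2l ?expR_ge0//; exact: IH.
    apply: ler_wpM2r; first exact: expR_ge0.
    rewrite mulrAC [in leRHS]exprS [in leRHS]mulrCA; apply: ler_wpM2r => //.
    exact: mulr_ge0.
  exists l, k, (2 * (D * gauss l L)); split => //.
  - by rewrite !mulr_ge0// expR_ge0.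
  - by move=> r rL; exact: (uk 0%N).
  - move=> r n rL; apply: (@geometric_cauchy (fun n => u n r)) => {}n.
    rewrite (le_trans (step n r rL))// mulrAC ler_wpM2r ?exprn_ge0 ?invr_ge0//.
    rewrite ler_wpM2l// le_gauss ?(ltW l0)//.
    by rewrite (le_trans rL)// ler_norm.
have cU : continuous U.
  move=> r; have [l [k [M [l0 M0 _ _ UM]]]] := local (`|r| + 1).
  apply/cvgrPdist_lt => e e0.
  have e3 : 0 < e / 3 by rewrite divr_gt0.
  have [n nM] := small_geometric M e3.
  have /cvgrPdist_lt/(_ _ e3) cn := cu n r.
  have r1 : `|r| <= `|r| + 1 by rewrite lerDl.
  have rn : (fun s : R => `|s|) @ r --> `|r| by exact: norm_continuous.
  near=> s.
  have s1 : `|s| <= `|r| + 1.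
    by apply: ltW; near: s; apply: (cvgr_lt _ rn); rewrite ltrDl.
  have -> : U r - U s = (U r - u n r) + (u n r - u n s) + (u n s - U s) by ring.
  have h1 : `|U r - u n r| < e / 3 by rewrite (le_lt_trans (UM _ n r1)).
  have h2' : `|u n r - u n s| < e / 3 by near: s.
  have h3 : `|u n s - U s| < e / 3 by rewrite distrC (le_lt_trans (UM _ n s1)).
  have := ler_normD (U r - u n r + (u n r - u n s)) (u n s - U s).
  have := ler_normD (U r - u n r) (u n r - u n s).
  by lra.
exists U => //; apply/funext => r; apply/eqP; rewrite -subr_eq0 -normr_le0.
apply/ler_addgt0Pl => e e0; rewrite addr0.
have [l [k [M [l0 M0 half uk UM]]]] := local `|r|.
have g0 : 0 <= gauss l r by rewrite expR_ge0.
have [n nM] := small_geometric (M * (1 + gauss l r)) e0.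
have -> : U r - taylor a (fun r => - expR (U r)) r =
    (U r - u n.+1 r) + (T (u n) r - T U r) by rewrite addrA subrK.
apply: ltW; apply: le_lt_trans nM; rewrite (le_trans (ler_normD _ _))//.
(* The first error is the distance to the limit, the second its image by [T]. *)
rewrite mulrDr mulr1 mulrDl lerD//.
  rewrite (le_trans (UM _ n.+1 _))// ler_wpM2l// exprS ler_piMl ?exprn_ge0 ?invr_ge0// invf_le1//.
  by rewrite ler1n.
have Uk s : `|s| <= `|r| -> U s <= k.
  move=> sr; apply/ler_addgt0Pl => e' e'0.
  have [n' n'M] := small_geometric M e'0.
  have := UM s n' sr; rewrite ler_norml => /andP[_ H].
  by have := uk _ sr; have := ule n' s; lra.
have [c0 cN1 cN2] : [/\ 0 <= expR k * (M * 2^-1 ^+ n),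
    continuous (fun r => - expR (u n r)) & continuous (fun r => - expR (U r))].
  split; [|exact: cNe..].
  by apply: mulr_ge0; [exact: expR_ge0|exact: mulr_ge0].
apply: (le_trans (taylor_contraction a l0 c0 cN1 cN2 _)).
  move=> t /andP[t0 t1].
  have tr : `|t * r| <= `|r| by rewrite normrM ger0_norm// ler_piMl.
  rewrite -opprD normrN distrC -!mulrA.
  apply: (le_trans (expR_lip (Uk _ tr) (le_trans (ule n _) (uk _ tr)))).
  apply: ler_wpM2l; first exact: expR_ge0.
  rewrite (le_trans (UM _ n tr))// mulrA ler_peMr//; first exact: mulr_ge0.
  exact: gauss_ge1 (ltW l0).
rewrite [leRHS]mulrAC; apply: ler_wpM2r => //.
rewrite mulrAC; apply: ler_piMl; first exact: mulr_ge0.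
by rewrite (le_trans half)// invf_le1// ler1n.
Unshelve. all: by end_near. Qed.

End integral_equation.

(** * Partial derivatives and radial functions *)

Section partial_derivatives.
Context (R : realType) (N : nat).
Implicit Types (F G : 'rV[R]_N -> R) (x : 'rV[R]_N) (i : 'I_N).

Lemma partial_cst i c : partial i (fun _ : 'rV[R]_N => c) = fun _ => 0.
Proof. by apply/funext => x; exact: derive_cst. Qed.

Lemma partialD i F G x : differentiable F x -> differentiable G x ->
  partial i (fun y => F y + G y) x = partial i F x + partial i G x.
Proof. by move=> dF dG; apply: deriveD; exact: diff_derivable. Qed.

Lemma partialM i F G x : differentiable F x -> differentiable G x ->
  partial i (fun y => F y * G y) x = partial i F x * G x + F x * partial i G x.
Proof.
move=> dF dG; rewrite /partial (@deriveM R _ F G x); try exact: diff_derivable.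
by rewrite addrC; congr (_ + _); exact: mulrC.
Qed.

Lemma partialZ i c F x : differentiable F x ->
  partial i (fun y => c * F y) x = c * partial i F x.
Proof.
move=> dF; have dc : differentiable (fun _ : 'rV[R]_N => c) x by exact: differentiable_cst.
by rewrite partialM// partial_cst /= mul0r add0r.
Qed.

Lemma differentiable1D F G x : differentiable F x -> differentiable G x ->
  differentiable (fun y => F y + G y) x.
Proof. exact: differentiableD. Qed.

Lemma differentiable1M F G x : differentiable F x -> differentiable G x ->
  differentiable (fun y => F y * G y) x.
Proof. exact: differentiableM. Qed.

Lemma partial_sum i (I : Type) (s : seq I) (F : I -> 'rV[R]_N -> R) x :
  (forall j, differentiable (F j) x) ->
  differentiable (fun y => \sum_(j <- s) F j y) x /\
  partial i (fun y => \sum_(j <- s) F j y) x = \sum_(j <- s) partial i (F j) x.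
Proof.
move=> dF; elim: s => [|j s [IHd IH]].
  under eq_fun do rewrite big_nil.
  by rewrite big_nil partial_cst; split => //; exact: differentiable_cst.
under eq_fun do rewrite big_cons.
rewrite big_cons partialD// IH; split => //; exact: differentiable1D.
Qed.

Lemma partial_coord i (j : 'I_N) x : partial i (fun y => y 0 j) x = (i == j)%:R.
Proof.
rewrite /partial deriveE; last exact: differentiable_coord.
have lf : linear (fun y : 'rV[R]_N => y 0 j : R^o) by move=> a u v; rewrite !mxE.
pose lM := GRing.isLinear.Build _ _ _ _ _ lf.
pose L : {linear 'rV[R]_N -> R^o} := HB.pack (fun y : 'rV[R]_N => y 0 j : R^o) lM.
rewrite (@diff_lin R _ _ L); last exact: coord_continuous.
by rewrite /= mxE eqxx eq_sym.
Qed.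

Lemma partial_comp i (f : R -> R) F a x : is_derive (F x) 1 f a ->
  differentiable F x ->
  differentiable (fun y => f (F y)) x /\
  partial i (fun y => f (F y)) x = a * partial i F x.
Proof.
move=> fa dF; have df : differentiable f (F x) by apply/derivable1_diffP; case: fa.
have dc : differentiable (fun y => f (F y)) x by apply: (@differentiable_comp _ _ _ _ F f).
split=> //; rewrite /partial !deriveE// (@diff_comp _ _ _ _ F f)//=.
rewrite deriv1E; last by case: fa.
by rewrite derive1E; case: fa => _ ->; rewrite mulrC.
Qed.

Definition normsq x : R := \sum_(i < N) x 0 i ^+ 2.

Lemma normsq_ge0 x : 0 <= normsq x.
Proof. by apply: sumr_ge0 => i _; exact: sqr_ge0. Qed.

Lemma enorm_ge0 x : 0 <= enorm x. Proof. exact: sqrtr_ge0. Qed.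

Lemma sqr_enorm x : enorm x ^+ 2 = normsq x.
Proof. by rewrite sqr_sqrtr// normsq_ge0. Qed.

Lemma differentiable_coordX (j : 'I_N) n x : differentiable (fun y : 'rV[R]_N => y 0 j ^+ n) x.
Proof.
elim: n => [|n IH]; first exact: differentiable_cst.
under eq_fun do rewrite exprS; apply: differentiable1M => //.
exact: differentiable_coord.
Qed.

Lemma differentiable_normsq x : differentiable normsq x.
Proof.
have dX j : differentiable (fun y : 'rV[R]_N => y 0 j ^+ 2) x.
  exact: differentiable_coordX.
have [i _|N0] := pickP (fun _ : 'I_N => true).
  by have [] := partial_sum i (index_enum 'I_N) dX.
have -> : normsq = fun=> 0 by apply/funext => y; apply: big_pred0 => j; have := N0 j.
exact: differentiable_cst.
Qed.

Lemma partial_normsq i x : partial i normsq x = 2 * x 0 i.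
Proof.
have dX j : differentiable (fun y : 'rV[R]_N => y 0 j ^+ 2) x.
  exact: differentiable_coordX.
rewrite [LHS](partial_sum i (index_enum 'I_N) dX).2.
have dc j := differentiable_coord x 0 j.
rewrite (bigD1 i)//= big1 ?addr0; last first.
  move=> j ji; under eq_fun do rewrite expr2.
  by rewrite partialM// partial_coord eq_sym (negbTE ji) /= mul0r mulr0 addr0.
under eq_fun do rewrite expr2.
by rewrite partialM// partial_coord eqxx /=; ring.
Qed.

Definition rad (f : R -> R) x := f (enorm x).

(** If [f' r = r * g r] then [f r = f 0 + r ^ 2 * avg 1 g r], so that [rad f] is
    a differentiable function of the polynomial [normsq], also at the origin,
    where the norm itself is not differentiable. *)
Lemma rad_derive i (f g : R -> R) x : continuous g ->
  (forall r : R, is_derive r 1 f (r * g r)) ->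
  differentiable (rad f) x /\ partial i (rad f) x = x 0 i * rad g x.
Proof.
move=> cg df; pose phi (t : R) := f 0 + t * avg 1 g (Num.sqrt t).
have E y : rad f y = phi (normsq y).
  by rewrite /phi -sqr_enorm [in LHS]/rad sqr_enorm -/(enorm y) -sqr_enorm
    (avg1_primitive _ cg df) addrC subrK.
have cA : continuous (avg 1 g) by exact: continuous_avg.
have cK : continuous (fun t => avg 1 g (Num.sqrt t)).
  by apply: (@continuous1_comp R (avg 1 g)) => //; exact: sqrt_continuous.
have dphi (t : R) : 0 <= t -> is_derive t 1 phi (2^-1 * g (Num.sqrt t)).
  rewrite le_eqVlt => /predU1P[<-|t0].
    have := is_derive1D (is_derive_cst (f 0) (0 : R) 1) (is_derive1_idM0 cK).
    by move/is_derive_eq; apply; rewrite sqrtr0 avg0 add0r mulrC.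
  have := @is_derive1_chain R f Num.sqrt t _ _ (df _) (is_derive1_sqrt t0).
  have -> : Num.sqrt t * g (Num.sqrt t) * (2 * Num.sqrt t)^-1 = 2^-1 * g (Num.sqrt t).
    by field; rewrite gt_eqF// sqrtr_gt0.
  apply: near_eq_is_derive.
  near=> s; rewrite /phi -[s in s * _]sqr_sqrtr.
    by rewrite (avg1_primitive _ cg df) addrC subrK.
  by apply: ltW; near: s; exact: lt_nbhsr.
have -> : rad f = fun y => phi (normsq y) by apply/funext.
have [d ->] := partial_comp i (dphi _ (normsq_ge0 x)) (differentiable_normsq x).
split => //; rewrite partial_normsq /rad /enorm -/(normsq x); field.
Unshelve. all: by end_near. Qed.

End partial_derivatives.

(** * Smoothness of radial solutions *)

Section radial_smoothness.
Context (R : realType).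
Implicit Types (f g h : R -> R) (S : (R -> R) -> Prop).

(** The operator [f' r = r * g r |-> g] acts on smooth even profiles as the
    derivative in [r ^ 2 / 2] does; a set of profiles stable under it consists of
    profiles of smooth radial functions, in any dimension. *)
Definition even_stable S := forall f, S f ->
  continuous f /\ exists2 g, S g & forall r : R, is_derive r 1 f (r * g r).

Section dimension.
Context (N : nat).
Implicit Types (F G : 'rV[R]_N -> R) (x : 'rV[R]_N).

(** Polynomials in the coordinates and in radial functions with profile in [S]:
    differentiating a radial function brings out a coordinate, so these, unlike
    the radial functions alone, are stable under partial derivatives. *)
Inductive radpoly S : ('rV[R]_N -> R) -> Prop :=
| radpoly_cst c : radpoly S (fun _ => c)
| radpoly_coord (i : 'I_N) : radpoly S (fun x => x 0 i)
| radpoly_rad f : S f -> radpoly S (rad f)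
| radpolyD F G : radpoly S F -> radpoly S G -> radpoly S (fun x => F x + G x)
| radpolyM F G : radpoly S F -> radpoly S G -> radpoly S (fun x => F x * G x).

Lemma radpoly_partial S F : even_stable S -> radpoly S F ->
  (forall x, differentiable F x) /\ forall i, radpoly S (partial i F).
Proof.
move=> HS; elim=> {F} [c|j|f Sf|F G rF [dF pF] rG [dG pG]|F G rF [dF pF] rG [dG pG]].
- split=> [x|i]; first exact: differentiable_cst.
  by rewrite partial_cst; exact: radpoly_cst.
- split=> [x|i]; first exact: differentiable_coord.
  have -> : partial i (fun y : 'rV[R]_N => y 0 j) = fun _ => (i == j)%:R.
    by apply/funext => x; exact: partial_coord.
  exact: radpoly_cst.
- have [_ [g Sg df]] := HS _ Sf; have [cg _] := HS _ Sg; split=> [x|i].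
    have [i _|N0] := pickP (fun _ : 'I_N => true); first by have [] := rad_derive i x cg df.
    have -> : @rad R N f = fun _ => f (@enorm R N 0).
      apply/funext => y; congr f; rewrite /enorm; congr Num.sqrt.
      by apply: eq_bigr => j _; have := N0 j.
    exact: differentiable_cst.
  have -> : partial i (rad f) = fun x : 'rV[R]_N => x 0 i * rad g x.
    by apply/funext => x; have [] := rad_derive i x cg df.
  by apply: radpolyM; [exact: radpoly_coord|exact: radpoly_rad].
- split=> [x|i]; first exact: differentiable1D.
  have -> : partial i (fun x => F x + G x) = fun x => partial i F x + partial i G x.
    by apply/funext => x; exact: partialD.
  exact: radpolyD.
- split=> [x|i]; first exact: differentiable1M.
  have -> : partial i (fun x => F x * G x) =
      fun x => partial i F x * G x + F x * partial i G x.
    by apply/funext => x; exact: partialM.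
  by apply: radpolyD; exact: radpolyM.
Qed.

Lemma smooth_rad S f : even_stable S -> S f -> smooth (@rad R N f).
Proof.
move=> HS Sf s x.
suff : radpoly S (foldr (@partial R N) (rad f) s) by case/(radpoly_partial HS).
elim: s => [|i s IH] /=; first exact: radpoly_rad.
by have [_] := radpoly_partial HS IH; exact.
Qed.

Lemma laplacian_rad f g h x : continuous g -> continuous h ->
  (forall r : R, is_derive r 1 f (r * g r)) ->
  (forall r : R, is_derive r 1 g (r * h r)) ->
  laplacian (rad f) x = N%:R * rad g x + enorm x ^+ 2 * rad h x.
Proof.
move=> cg ch df dg; rewrite /laplacian.
have pf i : partial i (rad f) = fun y : 'rV[R]_N => y 0 i * rad g y.
  by apply/funext => y; have [] := rad_derive i y cg df.
have E i : partial i (partial i (rad f)) x = rad g x + x 0 i ^+ 2 * rad h x.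
  have [dgx pg] := rad_derive i x ch dg.
  rewrite pf partialM//; last exact: differentiable_coord.
  by rewrite partial_coord eqxx pg mul1r mulrA -expr2.
under eq_bigr do rewrite E.
rewrite big_split /= sumr_const card_ord -mulr_suml mulr_natl.
by rewrite sqr_enorm.
Qed.

Lemma laplacianZ c F x : (forall y, differentiable F y) ->
  (forall i y, differentiable (partial i F) y) ->
  laplacian (fun y => c * F y) x = c * laplacian F x.
Proof.
move=> dF dpF; rewrite /laplacian mulr_sumr; apply: eq_bigr => i _.
have -> : partial i (fun y => c * F y) = fun y => c * partial i F y.
  by apply/funext => y; exact: partialZ.
exact: partialZ.
Qed.

End dimension.

Section solution.
Context (p : nat) (a : seq R) (u : R -> R).
Hypotheses (a0 : (0 < size a)%N) (cu : continuous u)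
  (uE : u = taylor p a (fun r => - expR (u r))).

Let w k := taylor p (drop k a) (fun r => - expR (u r)).

(** The profiles [w k] of the iterated Laplacians satisfy
    [w k' r = r * avg p (w k.+1) r], and the last one, [- expR u], is
    differentiated through [u]. Closing them under averages, sums and products
    gives a set stable under [f' r = r * g r |-> g]: this is the bootstrap that
    makes a merely continuous fixed point smooth. *)
Inductive profile_algebra : (R -> R) -> Prop :=
| profile_lap k : profile_algebra (w k)
| profile_sqr : profile_algebra (fun r => r ^+ 2)
| profile_cst c : profile_algebra (fun _ => c)
| profile_avg q f : profile_algebra f -> profile_algebra (avg q f)
| profileD f g : profile_algebra f -> profile_algebra g ->
    profile_algebra (fun r => f r + g r)
| profileM f g : profile_algebra f -> profile_algebra g ->
    profile_algebra (fun r => f r * g r).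

Let cNe : continuous (fun r => - expR (u r)).
Proof. by apply: continuous1N; exact: continuous1_expR. Qed.

Lemma continuous_lap_profile k : continuous (w k).
Proof. exact: continuous_taylor. Qed.

Lemma lap_profile_rec k : (k < size a)%N ->
  w k = fun r => nth 0 a k + invlap p (w k.+1) r.
Proof. by move=> ka; rewrite /w (drop_nth 0 ka). Qed.

Lemma is_derive_lap_profile k (r : R) (ka : (k < size a)%N) :
  is_derive r 1 (w k) (r * avg p (w k.+1) r).
Proof.
rewrite (lap_profile_rec ka); apply: is_derive_cst_invlap.
exact: continuous_lap_profile.
Qed.

Lemma continuous_profile f : profile_algebra f -> continuous f.
Proof.
elim=> {f} [k| |c|q f _ cf|f g _ cf _ cg|f g _ cf _ cg].
- exact: continuous_lap_profile.
- exact: continuous1X.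
- exact: continuous1_cst.
- exact: continuous_avg.
- exact: continuous1D.
- exact: continuous1M.
Qed.

Lemma even_stable_profile_algebra : even_stable profile_algebra.
Proof.
move=> f pf; split; first exact: continuous_profile.
elim: pf => {f} [k| |c|q f pf [g pg df]
  |f1 f2 pf1 [g1 pg1 df1] pf2 [g2 pg2 df2]
  |f1 f2 pf1 [g1 pg1 df1] pf2 [g2 pg2 df2]].
- have [ka|ka] := ltnP k (size a).
    by exists (avg p (w k.+1)); [exact/profile_avg/profile_lap
      |move=> r; exact: is_derive_lap_profile].
  exists (fun r => w k r * avg p (w 1%N) r).
    by apply: profileM; [exact: profile_lap|exact/profile_avg/profile_lap].
  have -> : w k = fun r => - 1 * expR (u r).
    by rewrite /w drop_oversize//; apply/funext => r; rewrite mulN1r.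
  move=> r; have du : is_derive r 1 u (r * avg p (w 1%N) r).
    by rewrite {1}uE -[a in taylor _ a]drop0; exact: is_derive_lap_profile.
  have := is_derive1M (is_derive_cst (-1 : R) r 1)
    (@is_derive1_chain R expR u r _ _ (is_derive_expR (u r)) du).
  by move/is_derive_eq; apply => /=; ring.
- exists (fun _ => 2); first exact: profile_cst.
  by move=> r; have := is_derive1X 2 r; move/is_derive_eq; apply; rewrite mulrC expr1.
- exists (fun _ => 0); first exact: profile_cst.
  by move=> r; rewrite mulr0; exact: is_derive_cst.
- exists (avg q.+2 g); first exact: profile_avg.
  by move=> r; apply: is_derive_avg => //; exact: continuous_profile.
- exists (fun r => g1 r + g2 r); first exact: profileD.
  by move=> r; rewrite mulrDr; exact: is_derive1D.
- exists (fun r => f1 r * g2 r + g1 r * f2 r).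
    by apply: profileD; exact: profileM.
  move=> r; have := is_derive1M (df1 r) (df2 r).
  by move/is_derive_eq; apply => /=; ring.
Qed.

Lemma profile_lap0 : profile_algebra u.
Proof. by rewrite uE -[a in taylor _ a]drop0; exact: profile_lap. Qed.

Lemma profile_derive1 f : profile_algebra f ->
  (forall r, derivable f r 1) /\
  exists2 g, profile_algebra g & derive1 f = fun r => r * g r.
Proof.
move=> pf; have [_ [g pg df]] := even_stable_profile_algebra pf.
split=> [r|]; first by case: (df r).
by exists g => //; apply/funext => r; rewrite derive1E; case: (df r).
Qed.

(** Two derivatives stay within the even profiles: if [f' r = r * g r] and
    [g' r = r * h r] then [f'' r = g r + r ^ 2 * h r]. *)
Lemma profile_derive2 f : profile_algebra f ->
  (forall r, derivable (derive1 f) r 1) /\ profile_algebra (derive1 (derive1 f)).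
Proof.
move=> pf; have [_ [g pg ->]] := profile_derive1 pf.
have [_ [h ph dg]] := even_stable_profile_algebra pg.
have d (r : R) : is_derive r 1 (fun r => r * g r) (g r + r ^+ 2 * h r).
  have := is_derive1M (is_derive_id r 1) (dg r).
  by move/is_derive_eq; apply => /=; ring.
split=> [r|]; first by case: (d r).
have -> : derive1 (fun r => r * g r) = fun r => g r + r ^+ 2 * h r.
  by apply/funext => r; rewrite derive1E; case: (d r).
by apply: profileD => //; apply: profileM => //; exact: profile_sqr.
Qed.

Lemma profile_derive1n_double f k : profile_algebra f ->
  profile_algebra (derive1n (2 * k) f).
Proof.
move=> pf; elim: k => [//|k IH]; rewrite mulnS addnC addn2 !derive1nS.
by have [] := profile_derive2 IH.
Qed.

Lemma derivable_profile f n r : profile_algebra f -> derivable (derive1n n f) r 1.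
Proof.
move=> pf; rewrite -[n]odd_double_half -mul2n addnC.
have pk := profile_derive1n_double n./2 pf.
case: (odd n); last by rewrite addn0; have [] := profile_derive1 pk.
by rewrite addn1 derive1nS; have [] := profile_derive2 pk.
Qed.

Lemma odd_derive1n_profile0 f k : profile_algebra f -> derive1n (2 * k).+1 f 0 = 0.
Proof.
move=> pf; rewrite derive1nS.
by have [_ [g _ ->]] := profile_derive1 (profile_derive1n_double k pf); rewrite mul0r.
Qed.

Local Notation radN := (@rad R p.+1).

Lemma laplacian_lap_profile k : (k < size a)%N ->
  laplacian (radN (w k)) = radN (w k.+1).
Proof.
move=> ka; apply/funext => x.
have cw := @continuous_lap_profile k.+1.
have [_ [g pg dw]] := even_stable_profile_algebra (profile_lap k.+1).
have cg := continuous_profile pg.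
have cA : continuous (avg p (w k.+1)) by exact: continuous_avg.
have cB : continuous (avg p.+2 g) by exact: continuous_avg.
have dA (r : R) : is_derive r 1 (avg p (w k.+1)) (r * avg p.+2 g r).
  exact: is_derive_avg.
rewrite (laplacian_rad x cA cB (fun r => is_derive_lap_profile r ka) dA).
exact: avg_by_parts.
Qed.

Lemma iter_laplacian_profile k : (k <= size a)%N ->
  iter k (@laplacian R p.+1) (radN u) = radN (w k).
Proof.
elim: k => [_|k IH ka]; first by rewrite /= {1}uE /w drop0.
by rewrite /= IH 1?ltnW// laplacian_lap_profile.
Qed.

Lemma iter_opp_laplacian_profile k : (k <= size a)%N ->
  iter k (fun F => \- @laplacian R p.+1 F) (radN u) =
  fun x => (-1) ^+ k * radN (w k) x.
Proof.
elim: k => [_|k IH ka].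
  by apply/funext => x; rewrite /= {1}uE /w drop0 mul1r.
rewrite /= IH 1?ltnW//; apply/funext => x /=.
have sw : smooth (radN (w k)).
  exact: smooth_rad even_stable_profile_algebra (profile_lap k).
rewrite laplacianZ; last 2 first.
- exact: (sw [::]).
- by move=> i; exact: (sw [:: i]).
by rewrite laplacian_lap_profile// exprS mulN1r mulNr.
Qed.

Lemma smooth_rad_solution : smooth (radN u).
Proof. exact: smooth_rad even_stable_profile_algebra profile_lap0. Qed.

Lemma radial_profile_solution : radial_profile (radN u) u.
Proof. by split => // n r; exact: derivable_profile profile_lap0. Qed.

Lemma laplacian_solution0 k : (k < size a)%N ->
  iter k (@laplacian R p.+1) (radN u) 0 = nth 0 a k.
Proof.
move=> ka; rewrite iter_laplacian_profile 1?ltnW// (lap_profile_rec ka) /rad.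
have -> : enorm (0 : 'rV[R]_p.+1) = 0.
  by rewrite /enorm big1 ?sqrtr0// => i _; rewrite mxE expr0n.
by rewrite invlap0 addr0.
Qed.

Lemma solution_equation x : odd (size a) ->
  iter (size a) (fun F => \- @laplacian R p.+1 F) (radN u) x = expR (radN u x).
Proof.
move=> oa; rewrite iter_opp_laplacian_profile// -signr_odd oa expr1 mulN1r.
by rewrite /w drop_size /rad /= opprK.
Qed.

End solution.
End radial_smoothness.

(** * Decay of solutions with alternating data *)

Section decay.
Context (R : realType) (p : nat).
Implicit Types (f g h : R -> R) (r t c e d : R) (s : seq R).

Lemma nonincreasing_from1 f (df : R -> R) r :
  (forall t, is_derive t 1 f (df t)) -> (forall t, 1 <= t -> df t <= 0) ->
  1 <= r -> f r <= f 1.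
Proof.
move=> fd df0 r1.
have cf : continuous f by move=> t; exact: is_derive1_continuous (fd t).
have cw : {within `[1, r], continuous f} by exact: continuous_subspaceT.
have [t tr E] := MVT_segment r1 (fun t _ => fd t) cw.
rewrite -subr_le0 E mulr_le0_ge0 ?subr_ge0// df0//.
by move: tr; rewrite in_itv /= => /andP[].
Qed.

Let scale01 r t : 0 <= r <= 1 -> 0 <= t <= 1 -> 0 <= t * r <= 1.
Proof. by move=> /andP[r0 r1] /andP[t0 t1]; rewrite mulr_ge0//= mulr_ile1. Qed.

Lemma invlap_cst_le c r : 0 <= c -> 0 <= r <= 1 ->
  invlap p (fun _ => c) r <= c.
Proof.
move=> c0 /andP[r0 r1]; rewrite invlap_cst.
have P1 : 1 <= p.+1%:R * 2 :> R by rewrite -natrM ler1n muln_gt0.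
rewrite -mulrA; apply: ler_piMr => //; apply: mulr_ile1.
- by rewrite invr_ge0 (le_trans _ P1).
- exact: sqr_ge0.
- by rewrite invf_le1// (lt_le_trans _ P1).
- exact: exprn_ile1.
Qed.

Lemma taylor_bound s f e c : 0 <= e -> 0 <= c -> continuous f ->
  (forall x, x \in s -> `|x| <= e) ->
  (forall r, 0 <= r <= 1 -> `|f r| <= c) ->
  forall r, 0 <= r <= 1 -> `|taylor p s f r| <= (size s)%:R * e + c.
Proof.
move=> e0 c0 cf + fc; elim: s => [_ r r01|x s IH se r r01] /=.
  by rewrite mul0r add0r fc.
have {}IH : forall r, 0 <= r <= 1 -> `|taylor p s f r| <= (size s)%:R * e + c.
  by apply: IH => y ys; apply: se; rewrite inE ys orbT.
set k := (size s)%:R * e + c in IH.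
have k0 : 0 <= k by rewrite addr_ge0// mulr_ge0.
have Gk := invlap_cst_le k0 r01.
have cT : continuous (taylor p s f) by exact: continuous_taylor.
have ck (y : R) : continuous (fun _ : R => y) by exact: continuous1_cst.
have GT : `|invlap p (taylor p s f) r| <= k.
  rewrite ler_norml; apply/andP; split.
  - rewrite lerNl; apply: le_trans Gk.
    rewrite -mulN1r -invlapZ//; apply: le_invlap => //.
      by apply: continuous1M.
    move=> t t01; rewrite mulN1r (le_trans (ler_norm _))// normrN.
    by apply: IH; exact: scale01.
  - apply: le_trans Gk; apply: le_invlap => // t t01.
    by rewrite (le_trans (ler_norm _))// IH//; exact: scale01.
have xe : `|x| <= e by apply: se; rewrite inE eqxx.
have -> : (size s).+1%:R * e = (size s)%:R * e + e by rewrite -addn1 natrD mulrDl mul1r.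
by rewrite (le_trans (ler_normD _ _))// addrAC addrC lerD.
Qed.

(** The [n]-fold inverse Laplacian of [1] is [monomial_coef n * r ^ (2 * n)]. *)
Fixpoint monomial_coef n : R :=
  if n is k.+1 then monomial_coef k / ((p + k.*2).+1%:R * k.*2.+2%:R) else 1.

Lemma monomial_coef_gt0 n : 0 < monomial_coef n.
Proof. by elim: n => //= n IH; rewrite divr_gt0// mulr_gt0. Qed.

Lemma monomial_coef_nonincreasing n k : (k <= n)%N -> monomial_coef n <= monomial_coef k.
Proof.
move=> kn; rewrite -(subnK kn); elim: (n - k)%N => //= j IH.
apply: le_trans IH; rewrite ler_pdivrMr ?mulr_gt0//.
by rewrite ler_peMr ?(ltW (monomial_coef_gt0 _))// -natrM ler1n muln_gt0.
Qed.

(** On the unit ball each inverse Laplacian of a constant is at most that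
    constant, so that data of size [e] contribute at most [size s * e], whereas
    the source [f <= - d] contributes a definite negative multiple of
    [r ^ (2 * size s)]. *)
Lemma taylor_ub s f e d : 0 <= e -> 0 <= d -> continuous f ->
  (forall x, x \in s -> `|x| <= e) ->
  (forall r, 0 <= r <= 1 -> f r <= - d) ->
  forall r, 0 <= r <= 1 -> taylor p s f r <=
    (size s)%:R * e - (monomial_coef (size s) * d) * r ^+ (size s).*2.
Proof.
move=> e0 d0 cf + fd; elim: s => [_ r r01|x s IH se r r01].
  by rewrite /= mul0r sub0r mulr1 mul1r fd.
have {}IH : forall r, 0 <= r <= 1 -> taylor p s f r <=
    (size s)%:R * e - (monomial_coef (size s) * d) * r ^+ (size s).*2.
  by apply: IH => y ys; apply: se; rewrite inE ys orbT.
have cT : continuous (taylor p s f) by exact: continuous_taylor.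
have c1 : continuous (fun _ : R => (size s)%:R * e) by exact: continuous1_cst.
have c2 : continuous (fun r : R => (monomial_coef (size s) * d) * r ^+ (size s).*2).
  by apply: continuous1M; [exact: continuous1_cst|exact: continuous1X].
have : invlap p (taylor p s f) r <= invlap p (fun r =>
    (size s)%:R * e - (monomial_coef (size s) * d) * r ^+ (size s).*2) r.
  by apply: le_invlap => //; [exact: continuous1B|move=> t t01; apply: IH; exact: scale01].
rewrite invlapB// invlap_monomial /=.
have k0 : 0 <= (size s)%:R * e by rewrite mulr_ge0.
have Gk := invlap_cst_le k0 r01.
have xe : `|x| <= e by apply: se; rewrite inE eqxx.
have xe' := le_trans (ler_norm x) xe.
have -> : (size s).+1%:R * e = (size s)%:R * e + e by rewrite -addn1 natrD mulrDl mul1r.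
rewrite [monomial_coef (size s) * d / _]mulrAC doubleS.
move=> H; rewrite [leRHS]addrAC [leRHS]addrC; apply: lerD => //.
by apply: (le_trans H); rewrite lerD2r.
Qed.

(** By [taylor_ub], when [e] is small with respect to [d] the source wins at
    radius one, both for the function and for its average. Past radius one, a
    nonpositive average of the Laplacian makes the function nonincreasing, and a
    nonpositive function makes [r ^ (p + 1)] times its average nonincreasing, so
    that the signs propagate by induction from the source. *)
Lemma taylor_le0_past1 s f e d n : 0 <= e -> 0 <= d -> continuous f ->
  (size s <= n)%N -> n%:R * e * (p + n.*2).+1%:R <= monomial_coef n * d ->
  (forall x, x \in s -> `|x| <= e) ->
  (forall r, 0 <= r -> f r <= 0) ->
  (forall r, 0 <= r <= 1 -> f r <= - d) ->
  forall r, 1 <= r -> taylor p s f r <= 0 /\ avg p (taylor p s f) r <= 0.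
Proof.
move=> e0 d0 cf + small + f0 fd; elim: s => [_ _ r r1|x s IH sn se].
  have r0 : 0 <= r by rewrite (le_trans ler01).
  split; first exact: f0.
  rewrite (@le_trans _ _ (avg p (fun x => 0 * x ^+ 0) r))//.
    apply: le_avg => //; last by move=> t /andP[t0 _]; rewrite mul0r f0// mulr_ge0.
    by apply: continuous1M; [exact: continuous1_cst|exact: continuous1X].
  by rewrite avg_monomial !mul0r.
have {}IH : forall r, 1 <= r -> taylor p s f r <= 0 /\ avg p (taylor p s f) r <= 0.
  by apply: IH; [exact: ltnW|move=> y ys; apply: se; rewrite inE ys orbT].
have cT : continuous (taylor p s f) by exact: continuous_taylor.
set w := taylor p (x :: s) f.
have cw : continuous w by exact: continuous_taylor.
have ub := taylor_ub e0 d0 cf se fd.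
set k := size (x :: s) in ub sn.
have smallk : k%:R * e * (p + k.*2).+1%:R <= monomial_coef k * d.
  have ke : k%:R * e <= n%:R * e by rewrite ler_wpM2r// ler_nat.
  rewrite (le_trans _ (le_trans small _))//.
    rewrite ler_pM ?mulr_ge0// ler_nat ltnS leq_add2l.
    by rewrite leq_double.
  by rewrite ler_wpM2r// monomial_coef_nonincreasing.
have ke0 : 0 <= k%:R * e by rewrite mulr_ge0.
have P1 : 1 <= (p + k.*2).+1%:R :> R by rewrite ler1n.
have w1 : w 1 <= 0.
  have := ub 1; rewrite lexx ler01 expr1n mulr1 => /(_ isT) /le_trans; apply.
  rewrite subr_le0 (le_trans _ smallk)// ler_peMr//.
have A1 : avg p w 1 <= 0.
  have c1 : continuous (fun y : R => (k%:R * e) * y ^+ 0).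
    by apply: continuous1M; [exact: continuous1_cst|exact: continuous1X].
  have c2 : continuous (fun y : R => - (monomial_coef k * d) * y ^+ k.*2).
    by apply: continuous1M; [exact: continuous1_cst|exact: continuous1X].
  have /le_trans : avg p w 1 <= avg p (fun y => (k%:R * e) * y ^+ 0 +
      - (monomial_coef k * d) * y ^+ k.*2) 1.
    apply: le_avg => //; first exact: continuous1D.
    by move=> t t01; rewrite !mulr1 mulNr; exact: ub.
  apply; rewrite avgD// !avg_monomial !expr1n !mulr1 addn0 mulNr subr_le0.
  rewrite ler_pdivlMr// (le_trans _ smallk)// mulrAC ler_piMr//.
    by rewrite mulr_ge0.
  by rewrite invf_le1// ler1n.
move=> r r1; have r0 : 0 < r by rewrite (lt_le_trans ltr01).
have wle t : 1 <= t -> w t <= 0.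
  move=> t1; apply: le_trans w1.
  apply: (nonincreasing_from1 (fun y => is_derive_cst_invlap p x y cT)) t1.
  move=> y y1; apply: mulr_ge0_le0; first exact: le_trans ler01 y1.
  by have [] := IH _ y1.
split; first exact: wle.
have : r ^+ p.+1 * avg p w r <= 0.
  apply: (@le_trans _ _ (1 ^+ p.+1 * avg p w 1)); last by rewrite expr1n mul1r.
  apply: (nonincreasing_from1 (fun y => is_derive_exprM_avg p y cw)) r1.
  move=> y y1; apply: mulr_ge0_le0; last exact: wle.
  by apply: exprn_ge0; rewrite (le_trans ler01).
by rewrite pmulr_rle0// exprn_gt0.
Qed.

(** With data [1, - A, e, - e, e, ...] the bilaplacian [w2] of the solution is at
    most [n * e <= n] on the unit ball and nonpositive outside, so that the
    Laplacian is at most [n - A] everywhere. The point is that the lower bound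
    [d] of [expR u] on the unit ball does not depend on [e], which can therefore
    be chosen after it. *)
Theorem decaying_solution_data m (B : R) : (3 <= m)%N -> 0 <= B ->
  exists a : seq R, [/\ size a = m,
    forall k, (k < m)%N -> Num.sg (nth 0 a k) = (-1) ^+ k &
    forall u : R -> R, continuous u -> u = taylor p a (fun r => - expR (u r)) ->
      forall r, 0 <= r -> u r <= 1 - B * r ^+ 2].
Proof.
case: m => [//|[//|n]] n3 B0.
pose A : R := n%:R + 2 * p.+1%:R * B.
(* [K] bounds the solution on the unit ball whatever the choice of [e <= 1]. *)
pose K : R := 1 + (A + (n%:R + expR 1)).
pose d := expR (- K).
pose e : R := monomial_coef n * d / (n.+1%:R * (p + n.*2).+1%:R).
have n0 : 0 < n%:R :> R by rewrite ltr0n; case: n n3 {A K d e}.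
have A0 : n%:R <= A by rewrite lerDl !mulr_ge0.
have K0 : 0 <= K.
  by rewrite /K; have := expR_ge0 (1 : R); move: A0 n0; lra.
have d0 : 0 < d by exact: expR_gt0.
have e0 : 0 < e by rewrite divr_gt0 ?mulr_gt0// monomial_coef_gt0.
have D1 : 1 <= n.+1%:R * (p + n.*2).+1%:R :> R by rewrite -natrM ler1n muln_gt0.
have e1 : e <= 1.
  rewrite ler_pdivrMr ?mul1r ?(lt_le_trans ltr01)//; apply: le_trans D1.
  rewrite mulr_ile1 ?(ltW d0) ?(ltW (monomial_coef_gt0 _))//.
    exact: (@monomial_coef_nonincreasing n 0).
  by rewrite -expR0 ler_expR oppr_le0.
have small : n%:R * e * (p + n.*2).+1%:R <= monomial_coef n * d.
  have : n.+1%:R * e * (p + n.*2).+1%:R = monomial_coef n * d.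
    by rewrite /e mulrAC mulrC divfK// mulf_neq0// pnatr_eq0.
  move=> <-; rewrite ler_wpM2r// ler_wpM2r ?(ltW e0)//.
  by rewrite ler_nat.
pose b := mkseq (fun i => (-1) ^+ i * e) n.
have bsz : size b = n by rewrite size_mkseq.
have be x : x \in b -> `|x| <= e.
  by move=> /mapP[i _ ->]; rewrite normrM normrX normrN1 expr1n mul1r gtr0_norm.
exists [:: 1, - A & b]; split; first by rewrite /= bsz.
  move=> [_|[_|k]]; first by rewrite sgr1.
    by rewrite expr1 /= sgrN gtr0_sg// (lt_le_trans n0).
  rewrite !ltnS => kn; rewrite /= nth_mkseq// sgrM (gtr0_sg e0) mulr1.
  by rewrite sgrX sgrN1 !exprS !mulN1r opprK.
move=> u cu uE.
set F := fun r => - expR (u r) in uE.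
have cF : continuous F by apply: continuous1N; exact: continuous1_expR.
have F0 r : F r <= 0 by rewrite oppr_le0 expR_ge0.
pose w2 := taylor p b F; pose w1 r := - A + invlap p w2 r.
have cw2 : continuous w2 by exact: continuous_taylor.
have cw1 : continuous w1.
  by apply: continuous1D; [exact: continuous1_cst|exact: continuous_invlap].
have u1 r : u r = 1 + invlap p w1 r by rewrite {1}uE.
have n0' := ltW n0; have e0' := ltW e0.
have ne : n%:R * e <= n%:R by rewrite ler_piMr.
have cc (y : R) : continuous (fun _ : R => y) by exact: continuous1_cst.
have w2n r : 0 <= r <= 1 -> w2 r <= n%:R.
  move=> r01; apply: le_trans ne.
  have := @taylor_ub b F e 0 e0' (lexx 0) cF be _ r r01.
  by rewrite bsz mulr0 mul0r subr0; apply => y _; rewrite oppr0.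
have w1n r : 0 <= r <= 1 -> w1 r <= - A + n%:R.
  move=> r01; rewrite lerD2l.
  have := invlap_cst_le n0' r01.
  by apply: le_trans; apply: le_invlap => // t t01; apply: w2n; exact: scale01.
have ule1 r : 0 <= r <= 1 -> u r <= 1.
  move=> r01; rewrite u1 gerDl.
  have := @le_invlap R p w1 (fun _ => 0) r cw1 (cc 0).
  rewrite invlap_cst mul0r mul0r; apply => t t01.
  rewrite (le_trans (w1n _ (scale01 r01 t01)))//; move: A0; lra.
have w2b r : 0 <= r <= 1 -> `|w2 r| <= n%:R + expR 1.
  have Fb y : 0 <= y <= 1 -> `|F y| <= expR 1.
    by move=> y01; rewrite normrN ger0_norm ?expR_ge0// ler_expR ule1.
  move=> r01; have := @taylor_bound b F e (expR 1) e0' (expR_ge0 1) cF be Fb r r01.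
  by move=> /le_trans; apply; rewrite bsz lerD2r.
have ub r : 0 <= r <= 1 -> `|u r| <= K.
  have A0' := le_trans n0' A0.
  have c0 : (0 : R) <= n%:R + expR 1 by apply: addr_ge0 => //; exact: expR_ge0.
  have sA x : x \in [:: - A] -> `|x| <= A.
    by rewrite inE => /eqP ->; rewrite normrN ger0_norm.
  have s1 (x : R) : x \in [:: 1] -> `|x| <= 1.
    by rewrite inE => /eqP ->; rewrite normr1.
  have w1b t : 0 <= t <= 1 -> `|w1 t| <= A + (n%:R + expR 1).
    by have := @taylor_bound [:: - A] w2 A _ A0' c0 cw2 sA w2b t; rewrite /= mul1r.
  have := @taylor_bound [:: 1] w1 1 _ ler01 (addr_ge0 A0' c0) cw1 s1 w1b r.
  by rewrite /= mul1r -u1; exact.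
have Fd r : 0 <= r <= 1 -> F r <= - d.
  move=> r01; rewrite lerN2 ler_expR lerNl.
  by rewrite (le_trans (ler_norm _))// normrN ub.
have bn : (size b <= n)%N by rewrite bsz.
have far := taylor_le0_past1 e0' (ltW d0) cF bn small be (fun r _ => F0 r) Fd.
have w1g r : 0 <= r -> w1 r <= - A + n%:R.
  move=> r0; have [r1|/ltW r1] := leP r 1; first by rewrite w1n// r0.
  apply: (@le_trans _ _ (w1 1)); last by rewrite w1n// lexx ler01.
  apply: (nonincreasing_from1 (fun y => is_derive_cst_invlap p (- A) y cw2)) r1.
  move=> y y1; apply: mulr_ge0_le0; first exact: le_trans ler01 y1.
  by have [] := far _ y1.
move=> r r0; rewrite u1 lerD2l.
have : invlap p w1 r <= invlap p (fun _ => - A + n%:R) r.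
  apply: (@le_invlap R p w1 (fun _ => - A + n%:R) r cw1 (cc (- A + n%:R))) => t /andP[t0 _].
  by apply: w1g; exact: mulr_ge0.
move=> /le_trans; apply; rewrite invlap_cst le_eqVlt; apply/orP; left; apply/eqP.
have P0 : p.+1%:R != 0 :> R by rewrite pnatr_eq0.
rewrite /A; move: p.+1%:R P0 => P P0; field; exact: P0.
Qed.

End decay.

(** * Integration over the whole space *)

Section integration.
Context (R : realType).
Local Notation T := (measurableTypeR R).

Section dimension.
Context (n : nat).
Implicit Types (f g F G : 'rV[R]_n -> R) (x : 'rV[R]_n) (t : n.-tuple T).

Definition row_of t : 'rV[R]_n := \row_i tnth t i.

Lemma rV_cvg (u : nat -> 'rV[R]_n) x :
  (forall i, u k 0 i @[k --> \oo] --> x 0 i) -> u @ \oo --> x.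
Proof.
move=> ux A [P nP PA]; near=> k; apply: PA => i j; rewrite ord1.
move: j; near: k; apply: filter_forall => j.
by apply: ux; have := nP ord0 j.
Unshelve. all: by end_near. Qed.

(** The sigma-algebra on tuples is the product one, not a Borel one. A continuous
    function is the pointwise limit of its values at the lower corners of finer
    and finer grids, and each approximation is constant on the countably many
    boxes of a grid. *)
Lemma measurable_row_of f : continuous f ->
  measurable_fun [set: n.-tuple T] (fun t => f (row_of t)).
Proof.
move=> cf.
pose z k (y : R) : int := Num.floor (k.+1%:R * y).
pose grid k (w : n.-tuple int) : 'rV[R]_n := \row_i ((tnth w i)%:~R / k.+1%:R).
pose approx k t := f (grid k [tuple z k (tnth t i) | i < n]).
apply: (@measurable_fun_cvg _ _ _ setT approx) => [k|t _].
  move=> _ Y mY; rewrite setTI.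
  rewrite (_ : _ @^-1` Y = \bigcup_(w in [set: n.-tuple int])
      [set t | Y (f (grid k w)) /\ forall i, z k (tnth t i) = tnth w i]); last first.
    apply/seteqP; split=> [t Yt|t [w _ /= [Yw tw]]].
      exists [tuple z k (tnth t i) | i < n] => //; split => // i.
      by rewrite tnth_mktuple.
    rewrite /preimage /= /approx (_ : [tuple _ | i < n] = w)//.
    by apply: eq_from_tnth => i; rewrite tnth_mktuple.
  apply: countable_bigcupT_measurable; first exact: countableP.
  move=> w; have [Yw|nYw] := pselect (Y (f (grid k w))); last first.
    by rewrite (_ : [set _ | _] = set0)//; apply/seteqP; split=> t //= [].
  rewrite (_ : [set _ | _] = \bigcap_(i in [set: 'I_n])
      (@tnth _ T ^~ i @^-1` [set y | z k y = tnth w i])); last first.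
    by apply/seteqP; split=> t /=; [move=> [_ tw] i _; exact: tw|
      move=> tw; split => // i; exact: tw].
  apply: fin_bigcap_measurable => // i _.
  rewrite -[X in measurable X]setTI; apply: measurable_tnth => //.
  rewrite (_ : [set y | _] = `[(tnth w i)%:~R / k.+1%:R, (tnth w i + 1)%:~R / k.+1%:R[%classic).
    exact: measurable_itv.
  apply/seteqP; split=> y /=; rewrite in_itv /= ler_pdivrMr// ltr_pdivlMr// ![y * _]mulrC.
    by move=> <-; exact: floor_itv.
  exact: floor_def.
apply: (@cvg_comp _ _ _ (fun k => grid k [tuple z k (tnth t i) | i < n]) f _ (nbhs (row_of t))).
  apply: rV_cvg => i; rewrite mxE.
  under eq_fun do rewrite mxE tnth_mktuple.
  apply/cvgrPdist_le => e e0; near=> k.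
  have k0 : 0 < k.+1%:R :> R by rewrite ltr0n.
  have /andP[l1 l2] := floor_itv (k.+1%:R * tnth t i).
  rewrite -/(z k _) in l1 l2.
  have -> : tnth t i - (z k (tnth t i))%:~R / k.+1%:R =
      (k.+1%:R * tnth t i - (z k (tnth t i))%:~R) / k.+1%:R.
    by rewrite mulrBl mulrAC mulfV ?mul1r// gt_eqF.
  rewrite ger0_norm; last by rewrite divr_ge0 ?subr_ge0// ltW.
  apply: (@le_trans _ _ k.+1%:R^-1).
    rewrite -[leRHS]mul1r ler_wpM2r ?invr_ge0 ?(ltW k0)//.
    by move: l2; rewrite intrD; lra.
  apply: ltW; near: k; exact: (near_infty_natSinv_lt (PosNum e0)).
exact: cf.
Unshelve. all: by end_near. Qed.

Definition compactly_supported f :=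
  exists L : R, forall x i, L < `|x 0 i| -> f x = 0.

Lemma compactly_supported_bounded f : continuous f -> compactly_supported f ->
  exists M, forall x, `|f x| <= M.
Proof.
move=> cf [L fL]; pose B := [set x : 'rV[R]_n | forall i, `[- `|L|, `|L|]%classic (x ord0 i)].
have cB : compact B.
  apply: (@rV_compact _ _ (fun=> `[- `|L|, `|L|]%classic)) => _.
  exact: segment_compact.
have B0 : B !=set0.
  by exists 0 => i /=; rewrite mxE in_itv /= oppr_le0 normr_ge0.
have cnf : {within B, continuous (fun x => `|f x|)}.
  apply: continuous_subspaceT => x; apply: (@continuous_comp _ _ _ f Num.norm).
    exact: cf.
  exact: norm_continuous.
have [c _ cM] := EVT_max_rV B0 cB cnf.
exists `|f c| => x; have [xB|nxB] := pselect (B x); first by apply: cM; rewrite inE.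
have [i Li] : exists i, `|L| < `|x 0 i|.
  apply: contrapT => H; apply: nxB => i /=; rewrite in_itv /= -ler_norml leNgt.
  by apply/negP => Lx; apply: H; exists i.
by rewrite (fL x i) ?normr0// (le_lt_trans (ler_norm _)).
Qed.

Lemma box_finite (L : R) :
  measurable [set t : n.-tuple T | forall i, `[- L, L]%classic (tnth t i)] /\
  (lebesgue_tuple R n [set t | forall i, `[(- L)%R, L]%classic (tnth t i)] < +oo)%E.
Proof.
split; last first.
  rewrite (@lebesgue_tuple_box R n (fun _ => `[- L, L]%classic))//.
  pose P (x : \bar R) := (0 <= x)%E /\ (x < +oo)%E.
  suff : P (\prod_(i < n) @lebesgue_measure R `[(- L)%R, L]%classic)%E by case.
  elim/big_ind: _ => [|x y [x0 xy] [y0 yy]|i _]; first by split; [exact: lee01|exact: ltry].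
    by split; [exact: mule_ge0|apply: lte_mul_pinfty => //; rewrite ge0_fin_numE].
  split; first exact: measure_ge0.
  by rewrite lebesgue_measure_itv; case: ifP => // _; rewrite -EFinD ltry.
rewrite (_ : [set t | _] = \bigcap_(i in [set: 'I_n])
    (@tnth _ T ^~ i @^-1` `[- L, L]%classic)); last first.
  by apply/seteqP; split=> t /= H i; [move=> _; exact: H|exact: H].
apply: fin_bigcap_measurable => // i _.
by rewrite -[X in measurable X]setTI; exact: measurable_tnth.
Qed.

(** These conditions ensure integrability and pass to the sections of a function,
    as the induction in [integral_partial0] requires. *)
Definition bounded_boxed (h : n.-tuple T -> R) := [/\ measurable_fun setT h,
  exists M : R, forall t, `|h t| <= M &
  exists L : R, forall t i, L < `|tnth t i| -> h t = 0].

Lemma bounded_boxed_integrable (h : n.-tuple T -> R) : bounded_boxed h ->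
  (lebesgue_tuple R n).-integrable setT (EFin \o h).
Proof.
move=> [mh [M hM] [L hL]]; have [mB fB] := box_finite L.
set B := [set t | _] in mB fB.
have -> : EFin \o h = (EFin \o h) \_ B.
  apply/funext => t; rewrite patchE; case: ifPn => //; rewrite notin_setE => nB.
  have [i Li] : exists i, L < `|tnth t i|.
    apply: contrapT => H; apply: nB => i /=; rewrite in_itv /= -ler_norml leNgt.
    by apply/negP => Lx; apply: H; exists i.
  by rewrite /= (hL t i).
apply: (integrable_mkcond _ mB).1; apply: measurable_bounded_integrable => //.
  exact: measurable_funTS.
exists M; split; first exact: num_real.
by move=> K MK t _ /=; rewrite (le_trans (hM t))// ltW.
Qed.

Lemma bounded_boxed_row_of f : continuous f -> compactly_supported f ->
  bounded_boxed (fun t => f (row_of t)).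
Proof.
move=> cf sf; split; first exact: measurable_row_of.
- by have [M fM] := compactly_supported_bounded cf sf; exists M => t; exact: fM.
- by have [L fL] := sf; exists L => t i Lt; apply: (fL _ i); rewrite mxE.
Qed.

End dimension.

Lemma integral_derive0 (F f : R -> R) : continuous f ->
  (forall s : R, is_derive s 1 F (f s)) ->
  (exists L : R, forall s, L < `|s| -> F s = 0 /\ f s = 0) ->
  (\int[@lebesgue_measure R]_s (f s)%:E = 0)%E.
Proof.
move=> cf dF [L FL]; pose K : R := `|L| + 1.
have LK (s : R) : K <= `|s| -> L < `|s|.
  move=> Ks; rewrite (le_lt_trans (ler_norm L))// (lt_le_trans _ Ks)//.
  by rewrite ltrDl.
have K0 : 0 < K by rewrite ltr_wpDl.
have cF : continuous F by move=> s; exact: is_derive1_continuous (dF s).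
have -> : (\int[@lebesgue_measure R]_s (f s)%:E =
    \int[@lebesgue_measure R]_(s in `[(- K)%R, K]) (f s)%:E)%E.
  rewrite [RHS]integral_mkcond; apply: eq_integral => s _; rewrite patchE.
  case: ifPn => //; rewrite notin_setE /= in_itv /= -ler_norml => /negP.
  by rewrite -ltNge => /ltW/LK/FL[_ ->].
rewrite (@continuous_FTC2 _ f F)//.
- have [FK _] := FL K (LK K (ler_norm K)).
  have [FNK _] : F (- K) = 0 /\ f (- K) = 0.
    by apply: FL; apply: LK; rewrite normrN ler_norm.
  by rewrite FK FNK subee.
- by rewrite gtrN.
- exact: continuous_subspaceT.
- split.
  + by move=> s _; case: (dF s).
  + by apply: cvg_at_right_filter; exact: cF.
  + by apply: cvg_at_left_filter; exact: cF.
- by move=> s _; rewrite derive1E; case: (dF s).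
Qed.

Definition put n (t : n.-tuple T) (i : 'I_n) (s : R) : n.-tuple T :=
  [tuple if j == i then s else tnth t j | j < n].

Lemma mktuple_consR n (s : R) (t : n.-tuple T) (h : 'I_n.+1 -> R) :
  h ord0 = s -> (forall j, h (lift ord0 j) = tnth t j) ->
  [tuple h j | j < n.+1] = tuple_consR (s, t).
Proof.
move=> h0 hS; apply: eq_from_tnth => j; rewrite tnth_mktuple.
by case: (unliftP ord0 j) => [k|] ->; rewrite ?hS ?h0 ?tnthS ?tnth0.
Qed.

Lemma put_cons0 n (x s : R) (t : n.-tuple T) :
  put (tuple_consR (x, t)) ord0 s = tuple_consR (s, t).
Proof. by apply: mktuple_consR => [|j]; rewrite ?eqxx//= tnthS. Qed.

Lemma put_consS n (x s : R) (t : n.-tuple T) (i : 'I_n) :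
  put (tuple_consR (x, t)) (lift ord0 i) s = tuple_consR (x, put t i s).
Proof.
apply: mktuple_consR => [|j]; first by rewrite tnth0.
by rewrite tnth_mktuple (inj_eq lift_inj) tnthS.
Qed.

Lemma bounded_boxed_section n (x : R) (h : n.+1.-tuple T -> R) : bounded_boxed h ->
  bounded_boxed (fun t : n.-tuple T => h (tuple_consR (x, t))).
Proof.
move=> [mh [M hM] [L hL]]; split.
- apply: measurableT_comp => //.
  apply: (measurableT_comp (@measurable_tuple_consR R n)).
  by apply/measurable_fun_pairP; split; [exact: measurable_cst|exact: measurable_id].
- by exists M => t; exact: hM.
- by exists L => t i Lt; apply: (hL _ (lift ord0 i)); rewrite tnthS.
Qed.

(** Induction on the dimension: Fubini's theorem lets the integral over the
    coordinate [i] be computed first, and it vanishes by [integral_derive0]. *)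
Lemma integral_partial0 n (i : 'I_n) (F f : n.-tuple T -> R) : bounded_boxed f ->
  (exists L : R, forall t, L < `|tnth t i| -> F t = 0) ->
  (forall t (s : R), is_derive s 1 (fun s => F (put t i s)) (f (put t i s))) ->
  (forall t, continuous (fun s : R => f (put t i s))) ->
  (\int[lebesgue_tuple R n]_t (f t)%:E = 0)%E.
Proof.
elim: n i F f => [[]//|n IH] i F f tf [L FL] dF cf.
have [mf [M fM] [L' fL]] := tf.
have mE : measurable_fun [set: n.+1.-tuple T] (fun t => (f t)%:E).
  exact/measurable_EFinP.
have int1 : ((@lebesgue_measure R) \x (lebesgue_tuple R n))%E.-integrable setT
    (fun z => (f (tuple_consR z))%:E).
  have /integrableP[_ fi] := bounded_boxed_integrable tf.
  apply/integrableP; split; first exact: measurableT_comp mE (@measurable_tuple_consR R n).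
  rewrite /= /lebesgue_tupleS ge0_integral_pushforward// in fi.
  - exact: measurable_tuple_consR.
  - by apply: measurableT_comp => //; exact: measurableT_comp.
rewrite /= /lebesgue_tupleS integral_pushforward//; last exact: measurable_tuple_consR.
rewrite preimage_setT -integral12_prod_meas1// /fubini_F /=.
case: (unliftP ord0 i) dF cf FL => [j|] -> dF cf FL.
- rewrite (eq_integral (fun _ => 0%E)) ?integral0// => x _.
  apply: (IH j (fun t => F (tuple_consR (x, t))) (fun t => f (tuple_consR (x, t)))).
  + exact: bounded_boxed_section.
  + by exists L => t Lt; apply: FL; rewrite tnthS.
  + move=> t s; have := dF (tuple_consR (x, t)) s.
    by under eq_fun do rewrite put_consS; rewrite put_consS.
  + move=> t; have := cf (tuple_consR (x, t)).
    by under eq_fun do rewrite put_consS.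
- rewrite (Fubini int1) /= (eq_integral (fun _ => 0%E)) ?integral0// => t _.
  apply: (@integral_derive0 (fun s => F (tuple_consR (s, t)))).
  + by have := cf (tuple_consR (0, t)); under eq_fun do rewrite put_cons0.
  + move=> s; have := dF (tuple_consR (0, t)) s.
    by under eq_fun do rewrite put_cons0; rewrite put_cons0.
  + exists (Num.max L L') => s; rewrite gt_max => /andP[Ls L's]; split.
      by apply: FL; rewrite tnth0.
    by apply: (fL _ ord0); rewrite tnth0.
Qed.

Section whole_space.
Context (N : nat).
Implicit Types (f g F G : 'rV[R]_N -> R) (x : 'rV[R]_N) (i : 'I_N).

Lemma integrableRN f : continuous f -> compactly_supported f ->
  (lebesgue_tuple R N).-integrable setT (EFin \o (fun t => f (row_of t))).
Proof. by move=> cf sf; apply: bounded_boxed_integrable; exact: bounded_boxed_row_of. Qed.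

Lemma integralRND f g : continuous f -> compactly_supported f ->
  continuous g -> compactly_supported g ->
  integralRN (fun x => f x + g x) = integralRN f + integralRN g.
Proof. by move=> cf sf cg sg; apply: RintegralD => //; exact: integrableRN. Qed.

Lemma le_integralRN f g : continuous f -> compactly_supported f ->
  continuous g -> compactly_supported g ->
  (forall x, f x <= g x) -> integralRN f <= integralRN g.
Proof. by move=> cf sf cg sg fg; apply: le_Rintegral => //; exact: integrableRN. Qed.

Lemma is_derive_line F x (v : 'rV[R]_N) (s : R) : differentiable F (x + s *: v) ->
  is_derive s 1 (fun s => F (x + s *: v)) ('D_v F (x + s *: v)).
Proof.
move=> dF; have [] := derivableP (@diff_derivable _ _ _ F _ v dF).
have E : (fun h : R => h^-1 *: (((fun s => F (x + s *: v)) \o shift s) (h *: 1) - F (x + s *: v))) =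
  (fun h => h^-1 *: ((F \o shift (x + s *: v)) (h *: v) - F (x + s *: v))).
  apply/funext => h /=; congr (_ *: (F _ - _)).
  by rewrite [h *: 1]mulr1 scalerDl addrCA.
move=> D _; apply: DeriveDef; last by rewrite /derive E.
by move: D; rewrite /derivable -E.
Qed.

Lemma compactly_supported_partial i G : compactly_supported G ->
  compactly_supported (partial i G).
Proof.
move=> [L GL]; exists L => x j Lx.
have cj : (fun y : 'rV[R]_N => `|y 0 j|) @ x --> `|x 0 j|.
  apply: (@cvg_comp _ _ _ (fun y : 'rV[R]_N => y 0 j) Num.norm _ (nbhs (x 0 j))).
    exact: coord_continuous.
  exact: norm_continuous.
rewrite /partial (@near_eq_derive _ _ _ G (cst 0)) ?derive_cst//.
by near=> y; apply: (GL _ j); near: y; exact: (cvgr_gt _ cj).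
Unshelve. all: by end_near. Qed.

Lemma row_of_put (t : N.-tuple T) i (s : R) :
  row_of (put t i s) = row_of (put t i 0) + s *: delta_mx 0 i.
Proof.
apply/rowP => j; rewrite !mxE !tnth_mktuple eqxx /=.
by case: eqP => _; rewrite ?mulr1 ?mulr0 ?addr0 ?add0r.
Qed.

Theorem integralRN_partial i G : (forall x, differentiable G x) ->
  continuous (partial i G) -> compactly_supported G ->
  integralRN (partial i G) = 0.
Proof.
move=> dG cG sG; have [L GL] := sG.
suff E : (\int[lebesgue_tuple R N]_t (partial i G (row_of t))%:E = 0)%E.
  by rewrite /integralRN /Rintegral E.
apply: (@integral_partial0 N i (fun t => G (row_of t))).
- by apply: bounded_boxed_row_of => //; exact: compactly_supported_partial.
- by exists L => t Lt; apply: (GL _ i); rewrite mxE.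
- move=> t s; rewrite row_of_put.
  have -> : (fun y => G (row_of (put t i y))) =
      (fun y => G (row_of (put t i 0) + y *: delta_mx 0 i)).
    by apply/funext => y; rewrite row_of_put.
  exact: is_derive_line.
- move=> t; under eq_fun do rewrite row_of_put.
  move=> s; apply: (@continuous_comp _ _ _ (fun s : R => row_of (put t i 0) + s *: delta_mx 0 i)
    (partial i G)); last exact: cG.
  by apply: cvgD; [exact: cvg_cst|exact: scalel_continuous].
Qed.

End whole_space.
End integration.

(** * Hardy and Rellich inequalities *)

Section hardy_rellich.
Context (R : realType) (N : nat).
Implicit Types (f g F G psi phi : 'rV[R]_N -> R) (x : 'rV[R]_N) (i : 'I_N).

Definition C1 F := (forall x, differentiable F x) /\
  forall i, continuous (partial i F).

Lemma C1_continuous F : C1 F -> continuous F.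
Proof. by move=> [dF _] x; exact: differentiable_continuous. Qed.

Lemma continuousRN_cst (c : R) : continuous (fun _ : 'rV[R]_N => c).
Proof. by move=> x; exact: cst_continuous. Qed.

Lemma continuousRN_D f g : continuous f -> continuous g ->
  continuous (fun x => f x + g x).
Proof. by move=> cf cg x; exact: (continuousD (cf x) (cg x)). Qed.

Lemma continuousRN_M f g : continuous f -> continuous g ->
  continuous (fun x => f x * g x).
Proof. by move=> cf cg x; exact: (continuousM (cf x) (cg x)). Qed.

Lemma continuousRN_sum (s : seq 'I_N) (h : 'I_N -> 'rV[R]_N -> R) :
  (forall i, continuous (h i)) -> continuous (fun x => \sum_(i <- s) h i x).
Proof.
move=> ch; elim: s => [|i s IH].
  by under eq_fun do rewrite big_nil; exact: continuousRN_cst.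
by under eq_fun do rewrite big_cons; exact: continuousRN_D.
Qed.

Lemma continuousRN_X f n : continuous f -> continuous (fun x => f x ^+ n).
Proof.
move=> cf; elim: n => [|n IH]; first exact: continuousRN_cst.
by under eq_fun do rewrite exprS; exact: continuousRN_M.
Qed.

Lemma C1_cst c : C1 (fun _ => c).
Proof.
split=> [x|i]; first exact: differentiable_cst.
by rewrite partial_cst; exact: continuousRN_cst.
Qed.

Lemma C1_D F G : C1 F -> C1 G -> C1 (fun x => F x + G x).
Proof.
move=> [dF cF] [dG cG]; split=> [x|i]; first exact: differentiable1D.
have -> : partial i (fun x => F x + G x) = fun x => partial i F x + partial i G x.
  by apply/funext => x; exact: partialD.
exact: continuousRN_D.
Qed.

Lemma C1_M F G : C1 F -> C1 G -> C1 (fun x => F x * G x).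
Proof.
move=> [dF cF] [dG cG]; split=> [x|i]; first exact: differentiable1M.
have -> : partial i (fun x => F x * G x) =
    fun x => partial i F x * G x + F x * partial i G x.
  by apply/funext => x; exact: partialM.
apply: continuousRN_D; apply: continuousRN_M => //; exact: C1_continuous.
Qed.

Lemma C1_coord i : C1 (fun x => x 0 i).
Proof.
split=> [x|j]; first exact: differentiable_coord.
have -> : partial j (fun y : 'rV[R]_N => y 0 i) = fun _ => (j == i)%:R.
  by apply/funext => x; exact: partial_coord.
exact: continuousRN_cst.
Qed.

Lemma smooth_C1 F : smooth F -> C1 F.
Proof.
move=> sF; split=> [x|i x]; first exact: (sF [::]).
by apply: differentiable_continuous; exact: (sF [:: i]).
Qed.

Lemma smooth_partial i F : smooth F -> smooth (partial i F).
Proof. by move=> sF s x; have := sF (rcons s i) x; rewrite foldr_rcons. Qed.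

Lemma smoothD F G : smooth F -> smooth G -> smooth (fun x => F x + G x).
Proof.
move=> sF sG s.
suff -> : foldr (@partial R N) (fun x => F x + G x) s =
    fun x => foldr (@partial R N) F s x + foldr (@partial R N) G s x.
  by move=> x; apply: differentiable1D; [exact: sF|exact: sG].
elim: s => [//|i s IH]; apply/funext => x /=; rewrite IH.
by apply: partialD; [exact: sF|exact: sG].
Qed.

Lemma smooth_sum (s : seq 'I_N) (h : 'I_N -> 'rV[R]_N -> R) :
  (forall i, smooth (h i)) -> smooth (fun x => \sum_(i <- s) h i x).
Proof.
move=> sh; elim: s => [|i s IH].
  under eq_fun do rewrite big_nil.
  move=> s x; suff [c ->] : exists c, foldr (@partial R N) (fun _ => 0) s = fun _ => c.
    exact: differentiable_cst.
  elim: s => [|i s [c IH]] /=; first by exists 0.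
  by exists 0; rewrite IH partial_cst.
by under eq_fun do rewrite big_cons; exact: smoothD.
Qed.

Lemma smooth_laplacian F : smooth F -> smooth (laplacian F).
Proof. by move=> sF; apply: smooth_sum => i; do 2 apply: smooth_partial. Qed.

Lemma compactly_supportedM F G : compactly_supported F ->
  compactly_supported (fun x => F x * G x).
Proof. by move=> [L FL]; exists L => x i Lx; rewrite (FL x i)// mul0r. Qed.

Lemma compactly_supportedD F G : compactly_supported F -> compactly_supported G ->
  compactly_supported (fun x => F x + G x).
Proof.
move=> [L FL] [K GK]; exists (Num.max L K) => x i; rewrite gt_max => /andP[Lx Kx].
by rewrite (FL x i)// (GK x i)// addr0.
Qed.

Lemma compactly_supported_sum (s : seq 'I_N) (h : 'I_N -> 'rV[R]_N -> R) :
  (forall i, compactly_supported (h i)) ->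
  compactly_supported (fun x => \sum_(i <- s) h i x).
Proof.
move=> sh; elim: s => [|i s IH].
  by under eq_fun do rewrite big_nil; exists 0.
by under eq_fun do rewrite big_cons; exact: compactly_supportedD.
Qed.

Lemma compactly_supportedX F n : compactly_supported F ->
  compactly_supported (fun x => F x ^+ n.+1).
Proof. by move=> sF; under eq_fun do rewrite exprS; exact: compactly_supportedM. Qed.

Lemma compactly_supported_laplacian F : compactly_supported F ->
  compactly_supported (laplacian F).
Proof.
by move=> sF; apply: compactly_supported_sum => i; do 2 apply: compactly_supported_partial.
Qed.

(** The divergence theorem for compactly supported fields, in the form in which
    both inequalities use it. *)
Lemma le_integralRN_divergence f g (G : 'I_N -> 'rV[R]_N -> R) :
  continuous f -> compactly_supported f ->
  continuous g -> compactly_supported g ->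
  (forall i, C1 (G i)) -> (forall i, compactly_supported (G i)) ->
  (forall x, f x - g x <= \sum_i partial i (G i) x) ->
  integralRN f <= integralRN g.
Proof.
move=> cf sf cg sg cG sG fg.
pose h x := \sum_i partial i (G i) x.
have [ch sh] : continuous h /\ compactly_supported h.
  split; first by apply: continuousRN_sum => i; exact: (cG i).2.
  by apply: compactly_supported_sum => i; exact: compactly_supported_partial.
have h0 : integralRN h = 0.
  rewrite /h; elim: (index_enum _) => [|i s IH].
    under eq_fun do rewrite big_nil.
    by rewrite /integralRN /Rintegral integral0.
  under eq_fun do rewrite big_cons.
  rewrite integralRND ?IH ?integralRN_partial ?addr0//.
  - exact: (cG i).1.
  - exact: (cG i).2.
  - exact: (cG i).2.
  - exact: compactly_supported_partial.
  - by apply: continuousRN_sum => j; exact: (cG j).2.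
  - by apply: compactly_supported_sum => j; exact: compactly_supported_partial.
rewrite -[leRHS]addr0 -h0 -integralRND//; apply: le_integralRN => //.
- exact: continuousRN_D.
- exact: compactly_supportedD.
- by move=> x; rewrite -lerBlDl; exact: fg.
Qed.

Section weight.
Context (eta : R) (eta0 : 0 < eta).

Definition weight x := (eta + normsq x)^-1.

Lemma weight_gt0 x : 0 < weight x.
Proof. by rewrite invr_gt0 ltr_pwDl// normsq_ge0. Qed.

Lemma normsq_weight_le1 x : normsq x * weight x <= 1.
Proof.
by rewrite ler_pdivrMr ?ltr_pwDl ?normsq_ge0// mul1r lerDr ltW.
Qed.

Lemma weightX_derive b i x : differentiable (fun y => weight y ^+ b) x /\
  partial i (fun y => weight y ^+ b) x =
    - (2 * b%:R) * x 0 i * weight x ^+ b.+1.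
Proof.
have s0 : eta + normsq x != 0 by rewrite gt_eqF// ltr_pwDl// normsq_ge0.
have d : is_derive (normsq x) 1 (fun t : R => (eta + t)^-1 ^+ b) (- b%:R * weight x ^+ b.+1).
  have d1 : is_derive (normsq x) 1 (fun t : R => eta + t) 1.
    have := is_derive1D (is_derive_cst eta (normsq x) 1) (is_derive_id (normsq x) 1).
    by rewrite add0r.
  have d2 := is_derive1V s0 d1.
  have := @is_derive1_chain R (fun y => y ^+ b) (fun t => (eta + t)^-1) (normsq x) _ _
    (is_derive1X b _) d2.
  move/is_derive_eq; apply; rewrite mulr1 -/(weight x) -exprVn mulrN mulNr -mulrA.
  by case: b => [|b /=]; rewrite ?mul0r// -exprD addn2.
have [dw ->] := partial_comp i d (differentiable_normsq x).
by split=> //; rewrite partial_normsq; ring.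
Qed.

Lemma C1_weightX b : C1 (fun x => weight x ^+ b).
Proof.
split=> [x|i].
  have [i _|N0] := pickP (fun _ : 'I_N => true); first by have [] := weightX_derive b i x.
  have -> : (fun y => weight y ^+ b) = fun _ => (eta + 0)^-1 ^+ b.
    by apply/funext => y; rewrite /weight /normsq big_pred0// => j; have := N0 j.
  exact: differentiable_cst.
have -> : partial i (fun y => weight y ^+ b) =
    fun x => - (2 * b%:R) * x 0 i * weight x ^+ b.+1.
  by apply/funext => x; have [] := weightX_derive b i x.
move=> x; apply: differentiable_continuous.
apply: differentiable1M; last by have [] := weightX_derive b.+1 i x.
by apply: differentiable1M; [exact: differentiable_cst|exact: differentiable_coord].
Qed.

Lemma continuous_weightX b : continuous (fun x => weight x ^+ b).
Proof. exact: C1_continuous (C1_weightX b). Qed.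

(** The field is [psi ^ 2 * weight * x]. Its divergence contains
    [(N - 2) * psi ^ 2 * weight] at least, and the cross term is absorbed by the
    squares of [partial i psi + psi * weight * x_i]. *)
Lemma hardy psi : (4 <= N)%N -> smooth psi -> compactly_supported psi ->
  integralRN (fun x => psi x ^+ 2 * weight x ^+ 1) <= integralRN (grad_sq psi).
Proof.
move=> N4 sp cp; have Cp := smooth_C1 sp; have cpsi := C1_continuous Cp.
pose G i x := (psi x * psi x) * (x 0 i * weight x ^+ 1).
apply: (@le_integralRN_divergence _ _ G).
- by apply: continuousRN_M; [exact: continuousRN_X|exact: continuous_weightX].
- by apply: compactly_supportedM; exact: compactly_supportedX.
- by apply: continuousRN_sum => i; apply: continuousRN_X; exact: Cp.2.
- apply: compactly_supported_sum => i; apply: compactly_supportedX.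
  exact: compactly_supported_partial.
- move=> i; apply: C1_M; first exact: C1_M.
  by apply: C1_M; [exact: C1_coord|exact: C1_weightX].
- by move=> i; do 2 apply: compactly_supportedM.
move=> x; pose w := weight x.
have E i : partial i (G i) x = 2 * psi x * (x 0 i * partial i psi x) * w +
    psi x ^+ 2 * w - 2 * psi x ^+ 2 * w ^+ 2 * x 0 i ^+ 2.
  have dp : differentiable psi x := Cp.1 x.
  have [dw pw] := weightX_derive 1 i x.
  have dc : differentiable (fun y : 'rV[R]_N => y 0 i) x := differentiable_coord x 0 i.
  rewrite /G partialM; last 2 first.
  - exact: differentiable1M.
  - exact: differentiable1M.
  by rewrite !partialM// partial_coord eqxx pw -/w /=; ring.
have P i : - (partial i psi x ^+ 2 + psi x ^+ 2 * w ^+ 2 * x 0 i ^+ 2) +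
    psi x ^+ 2 * w - 2 * psi x ^+ 2 * w ^+ 2 * x 0 i ^+ 2 <= partial i (G i) x.
  rewrite E lerD2r lerD2r -subr_ge0.
  have -> : 2 * psi x * (x 0 i * partial i psi x) * w -
    - (partial i psi x ^+ 2 + psi x ^+ 2 * w ^+ 2 * x 0 i ^+ 2) =
    (partial i psi x + psi x * w * x 0 i) ^+ 2 by ring.
  exact: sqr_ge0.
apply: le_trans (ler_sum _ (fun i _ => P i)).
rewrite sumrB big_split /= sumrN big_split /= -!mulr_sumr sumr_const card_ord.
rewrite -/(grad_sq psi x) -/(normsq x) -/w.
have w0 : 0 < w := weight_gt0 x.
have w1 : normsq x * w <= 1 := normsq_weight_le1 x.
have N4' : 4 <= N%:R :> R by rewrite ler_nat.
rewrite expr1 -/w -[w *+ N]mulr_natl.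
set P2 := psi x ^+ 2; set q := normsq x in w1 *.
have P20 : 0 <= P2 * w by rewrite mulr_ge0 ?sqr_ge0// ltW.
have H1 : P2 * w * (q * w) <= P2 * w by rewrite ler_piMr.
have H2 : 4 * (P2 * w) <= N%:R * (P2 * w) by rewrite ler_wpM2r.
have -> : P2 * w ^+ 2 * q = P2 * w * (q * w) by ring.
have -> : 2 * P2 * w ^+ 2 * q = 2 * (P2 * w * (q * w)) by ring.
by move: H1 H2; lra.
Qed.

(** With [W = weight ^ (b + 1)] the field is [grad (psi ^ 2) * W - psi ^ 2 * grad W],
    of divergence [laplacian (psi ^ 2) * W - psi ^ 2 * laplacian W]. The weight
    satisfies
    [- laplacian W >= 2 * (b + 1) * (N - 2 * b - 4) * weight ^ (b + 2)], and the
    cross term [2 * psi * laplacian psi * W] is absorbed by the square of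
    [psi * weight + laplacian psi]. *)
Lemma rellich b psi : (2 * b.+1 + 3 <= N)%N -> smooth psi -> compactly_supported psi ->
  integralRN (fun x => psi x ^+ 2 * weight x ^+ b.+2) <=
  integralRN (fun x => laplacian psi x ^+ 2 * weight x ^+ b).
Proof.
move=> bN sp cp; have Cp := smooth_C1 sp; have cpsi := C1_continuous Cp.
pose c : R := b.+1%:R.
pose G i x := 2 * (psi x * (partial i psi x * weight x ^+ b.+1)) +
  2 * c * ((psi x * psi x) * (x 0 i * weight x ^+ b.+2)).
have Cpi i : C1 (partial i psi) by apply: smooth_C1; exact: smooth_partial.
apply: (@le_integralRN_divergence _ _ G).
- by apply: continuousRN_M; [exact: continuousRN_X|exact: continuous_weightX].
- by apply: compactly_supportedM; exact: compactly_supportedX.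
- apply: continuousRN_M; last exact: continuous_weightX.
  by apply: continuousRN_X; apply: C1_continuous; apply: smooth_C1; exact: smooth_laplacian.
- apply: compactly_supportedM; apply: compactly_supportedX.
  exact: compactly_supported_laplacian.
- move=> i; apply: C1_D; apply: C1_M; try exact: C1_cst.
    by apply: C1_M => //; apply: C1_M; [exact: Cpi|exact: C1_weightX].
  apply: C1_M; first exact: C1_M.
  by apply: C1_M; [exact: C1_coord|exact: C1_weightX].
- have [L pL] := cp; move=> i; exists L => x j Lx.
  by rewrite /G (pL x j)// !mul0r !mulr0 addr0.
move=> x; pose w := weight x; pose v := w ^+ b.
have E i : partial i (G i) x = 2 * v * w * partial i psi x ^+ 2 +
   2 * v * w * psi x * partial i (partial i psi) x + 2 * c * psi x ^+ 2 * v * w ^+ 2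
   - 4 * c * (c + 1) * psi x ^+ 2 * v * w ^+ 3 * x 0 i ^+ 2.
  have dp : differentiable psi x := Cp.1 x.
  have dpi : differentiable (partial i psi) x := (Cpi i).1 x.
  have [dw1 pw1] := weightX_derive b.+1 i x.
  have [dw2 pw2] := weightX_derive b.+2 i x.
  have dc : differentiable (fun y : 'rV[R]_N => y 0 i) x := differentiable_coord x 0 i.
  have d1 := differentiable1M dpi dw1.
  have d2 := differentiable1M dp d1.
  have d3 := differentiable1M dp dp.
  have d4 := differentiable1M dc dw2.
  have d5 := differentiable1M d3 d4.
  rewrite /G partialD; [|exact: differentiable1M (differentiable_cst _ _) _..].
  rewrite (partialZ i 2 d2) (partialZ i (2 * c) d5) (partialM i dp d1) (partialM i dpi dw1).
  rewrite (partialM i d3 d4) (partialM i dp dp) (partialM i dc dw2).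
  rewrite partial_coord eqxx pw1 pw2 -/w.
  have -> : b.+2%:R = c + 1 :> R by rewrite -natr1.
  by rewrite -/c !exprS -/v /=; ring.
rewrite (eq_bigr _ (fun i _ => E i)) sumrB !big_split /= -!mulr_sumr sumr_const card_ord.
rewrite -/(grad_sq psi x) -/(laplacian psi x) -/(normsq x) -/w.
have w0 : 0 < w := weight_gt0 x.
have v0 : 0 <= v by rewrite exprn_ge0// ltW.
have w1 : normsq x * w <= 1 := normsq_weight_le1 x.
have g0 : 0 <= grad_sq psi x by apply: sumr_ge0 => i _; exact: sqr_ge0.
have c1 : 1 <= c by rewrite ler1n.
have Nc : 2 * c + 3 <= N%:R by rewrite -natrM -natrD ler_nat.
rewrite -[_ *+ N]mulr_natl.
set D := laplacian psi x; set g := grad_sq psi x in g0 *; set q := normsq x in w1 *.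
have -> : psi x ^+ 2 * w ^+ b.+2 = psi x ^+ 2 * v * w ^+ 2 by rewrite !exprS -/v; ring.
set a := psi x ^+ 2 * v * w ^+ 2.
have a0 : 0 <= a.
  by apply: mulr_ge0 (sqr_ge0 _); apply: mulr_ge0 => //; exact: sqr_ge0.
have S : 0 <= v * (psi x * w + D) ^+ 2 by apply: mulr_ge0 => //; exact: sqr_ge0.
have H0 : 0 <= 2 * v * w * g.
  by apply: mulr_ge0 => //; apply: mulr_ge0; [exact: mulr_ge0|exact: ltW].
have H1 : 4 * c * (c + 1) * a * (q * w) <= 4 * c * (c + 1) * a.
  by apply: ler_piMr => //; apply: mulr_ge0 => //; apply: mulr_ge0; lra.
have H2 : c * a * (2 * c + 3) <= c * a * N%:R.
  by apply: ler_wpM2l => //; apply: mulr_ge0 => //; lra.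
have H3 : a <= c * a by rewrite ler_peMl.
have -> : 4 * c * (c + 1) * psi x ^+ 2 * v * w ^+ 3 * q = 4 * c * (c + 1) * a * (q * w).
  by rewrite /a; ring.
have -> : 2 * c * psi x ^+ 2 * v * (w * (N%:R * w)) = 2 * (c * a * N%:R).
  by rewrite /a; ring.
have E2 : v * (psi x * w + D) ^+ 2 = a + 2 * v * w * psi x * D + D ^+ 2 * v.
  by rewrite /a; ring.
rewrite -/v; move: S H0 H1 H2 H3; rewrite E2; lra.
Qed.

(** Each Laplacian trades two powers of the weight by [rellich], and the last
    power goes into the gradient by [hardy]. The first step is the one that
    requires [N > 2 * (2 * j + 1)]. The constant is one for every [eta]. *)
Theorem hardy_rellich j phi : (4 <= N)%N -> (2 * j.*2.+1 < N)%N -> smooth phi ->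
  compactly_supported phi ->
  integralRN (fun x => phi x ^+ 2 * weight x ^+ j.*2.+1) <=
  integralRN (grad_sq (iter j (@laplacian R N) phi)).
Proof.
move=> N4; elim: j phi => [|j IH] phi jN sp cp; first exact: hardy.
apply: (@le_trans _ _ (integralRN (fun x => laplacian phi x ^+ 2 * weight x ^+ j.*2.+1))).
  rewrite doubleS; apply: (@rellich j.*2.+1) => //.
  by move: jN; rewrite doubleS -mul2n; lia.
rewrite iterSr; apply: IH; [by move: jN; rewrite doubleS -mul2n; lia|exact: smooth_laplacian|].
exact: compactly_supported_laplacian.
Qed.

End weight.

Lemma test_function_compactly_supported phi : test_function phi ->
  compactly_supported phi.
Proof.
move=> [_ /compact_bounded[M [_ MB]]]; exists (M + 1) => x i Mx.
apply: contrapT => /eqP px.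
have : `|x| <= M + 1 by apply: (MB (M + 1)); rewrite ?ltrDl//; exact: subset_closure.
apply/negP; rewrite -ltNge (lt_le_trans Mx)// [leRHS]/Num.norm/= mx_normrE.
exact: (le_bigmax _ (fun ij => `|x ij.1 ij.2|) (0, i)).
Qed.

End hardy_rellich.

(** * Existence of a stable solution *)

Section stability.
Context (R : realType).

Lemma stable_of_weight_bound N m (eta : R) (u : 'rV[R]_N -> R) :
  0 < eta -> odd m -> (4 <= N)%N -> (2 * m < N)%N -> continuous u ->
  (forall x, expR (u x) <= weight eta x ^+ m) -> stable_odd m u.
Proof.
move=> eta0 om N4 mN cu ub phi tphi.
have sp := tphi.1; have cp := test_function_compactly_supported tphi.
have mE : m = (m.-1./2).*2.+1 by case: m om {mN ub} => //= k /negbTE ok; rewrite even_halfK// ok.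
have cphi := C1_continuous (smooth_C1 sp).
have c2 : continuous (fun x => phi x ^+ 2) by exact: continuousRN_X.
have s2 : compactly_supported (fun x => phi x ^+ 2) by exact: compactly_supportedX.
have ce : continuous (fun x => expR (u x)).
  move=> x; apply: (@continuous_comp _ _ _ u expR); first exact: cu.
  exact: continuous_expR.
rewrite subr_ge0; rewrite mE in mN.
apply: le_trans (hardy_rellich eta0 N4 mN sp cp).
rewrite -mE; under eq_fun do rewrite mulrC.
apply: le_integralRN.
- exact: continuousRN_M.
- exact: compactly_supportedM.
- by apply: continuousRN_M => //; exact: continuous_weightX.
- exact: compactly_supportedM.
- by move=> x; rewrite ler_wpM2l ?sqr_ge0.
Qed.

(** Since [1 / e + q = (1 + e * q) / e] with [1 + e * q <= exp (e * q)], a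
    Gaussian of rate [m * e] lies below the weight with [eta = 1 / e]. *)
Lemma gaussian_le_weight m (q : R) : (0 < m)%N -> 0 <= q ->
  expR (1 - m%:R * expR 1 * q) <= (expR (- 1) + q)^-1 ^+ m.
Proof.
move=> m0 q0; have e0 : 0 < expR (- 1) :> R by exact: expR_gt0.
have e1 : expR (- 1) <= 1 :> R by rewrite -expR0 ler_expR oppr_le0.
have eq0 : 0 < expR (- 1) + q by rewrite ltr_pwDl.
rewrite exprVn -[leRHS]mul1r ler_pdivlMr ?exprn_gt0//.
have -> : expR (- 1) + q = expR (- 1) * (1 + expR 1 * q).
  by rewrite mulrDr mulr1 mulrA -expRD addNr expR0 mul1r.
have H : (1 + expR 1 * q) ^+ m <= expR (m%:R * expR 1 * q).
  rewrite -mulrA expRM_natl; apply: lerXn2r; rewrite ?nnegrE ?expR_ge0//.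
    by rewrite addr_ge0// mulr_ge0// expR_ge0.
  exact: expR_ge1Dx.
have E : expR (- 1) ^+ m <= expR (- 1) :> R.
  by rewrite -[leRHS]expr1 ler_wiXn2l// ltW.
rewrite exprMn.
apply: (@le_trans _ _ (expR (1 - m%:R * expR 1 * q) * (expR (- 1) * expR (m%:R * expR 1 * q)))).
  by rewrite ler_wpM2l ?expR_ge0// ler_pM// ?exprn_ge0 ?expR_ge0// addr_ge0// mulr_ge0// expR_ge0.
by rewrite -!expRD; set y := _ * q; rewrite (_ : 1 - y + (- 1 + y) = 0) ?expR0//; ring.
Qed.

End stability.

Theorem theorem3p1 (R : realType) (m N : nat) (hm3 : (3 <= m)%N)
    (hmodd : odd m) (hN : (2 * m < N)%N) :
  exists (a : 'I_m -> R) (u : 'rV[R]_N -> R) (U : R -> R),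
    [/\ forall k : 'I_m, Num.sg (a k) = (-1) ^+ k,
        smooth u /\ radial_profile u U,
        forall x, iter m (fun f => \- laplacian f) u x = expR (u x),
        (forall k : 'I_m, derive1n (2 * k).+1 U 0 = 0) /\
        (forall k : 'I_m, iter k (@laplacian R N) u 0 = a k) &
        stable_odd m u].
Proof.
case: N hN => [|p]; first by rewrite ltn0.
move=> hN.
have B0 : 0 <= m%:R * expR 1 :> R by rewrite mulr_ge0// expR_ge0.
have [a [sa sg decay]] := decaying_solution_data p hm3 B0.
have m0 : (0 < m)%N by exact: leq_trans hm3.
have a0 : (0 < size a)%N by rewrite sa.
have [U cU UE] := integral_equation_solution p a0.
pose u : 'rV[R]_p.+1 -> R := rad U.
have su : smooth u := smooth_rad_solution a0 cU UE.
exists (fun k => nth 0 a k), u, U; split.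
- by move=> k; exact: sg.
- by split; [exact: su|exact: radial_profile_solution a0 cU UE].
- by move=> x; rewrite -{1}sa; apply: (solution_equation a0 cU UE); rewrite sa.
- split=> k.
    exact: (odd_derive1n_profile0 a0 cU UE k (profile_lap0 UE)).
  by apply: (laplacian_solution0 a0 cU UE); rewrite sa.
- have N4 : (4 <= p.+1)%N by move: hm3 hN; lia.
  apply: (@stable_of_weight_bound _ _ _ (expR (- 1))) => //.
    exact: C1_continuous (smooth_C1 su).
  move=> x; apply: (@le_trans _ _ (expR (1 - m%:R * expR 1 * normsq x))).
    rewrite ler_expR -sqr_enorm; apply: (decay U cU UE).
    exact: enorm_ge0.
  by apply: gaussian_le_weight => //; exact: normsq_ge0.
Qed.
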